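(* Let $n$ be a positive integer and let $B_n$ be the braid group on $n$ strings. Let $\Omega$ be the graph whose set of vertices is $\Upsilon=\{\alpha\sigma_i^2\alpha^{-1} : \alpha\in B_n,\ 1\le i\le n-1\}\subset B_n$, and in which two distinct vertices $u,v$ span an edge $\{u,v\}$ if and only if $uv=vu$ in $B_n$. Let $\mathcal{M}(\Omega)$ be the graph monoid of $\Omega$ and let $\nu\colon\mathcal{M}(\Omega)\to\mathbb{Z}[B_n]$ be the multiplicative (monoid) homomorphism defined by $\nu(u)=u-1$ for all $u\in\Upsilon$. Then $\nu$ is injective.
   Context: The braid group $B_n$ is the group with generators $\sigma_1,\dots,\sigma_{n-1}$ and relations $\sigma_j\sigma_k=\sigma_k\sigma_j$ if $|j-k|>1$, and $\sigma_j\sigma_k\sigma_j=\sigma_k\sigma_j\sigma_k$ if $|j-k|=1$. $\mathbb{Z}[B_n]$ is its integral group ring, regarded as a monoid under multiplication. For a graph $\Gamma$ (no loops, no multiple edges, possibly infinite) with vertex set $X$ and edge set $E(\Gamma)$, the graph monoid of $\Gamma$ is the monoid given by the monoid presentation $\mathcal{M}(\Gamma)=\langle X \mid xy=yx \text{ if } \{x,y\}\in E(\Gamma)\rangle^+$. *)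

(* Defs.v *)
From HB Require Import structures.
From mathcomp Require Import all_boot all_order all_algebra finmap.
From mathcomp Require Import boolp.
From mathcomp.multinomials Require Import monalg.

Set Implicit Arguments.
Unset Strict Implicit.
Unset Printing Implicit Defensive.

Import GRing.Theory.
Local Open Scope quotient_scope.

Section MonoidPresentation.
Context {X : choiceType} (R : seq X -> seq X -> Prop).

Inductive pres_congr : seq X -> seq X -> Prop :=
| pres_congr_rel u v of R u v : pres_congr u v
| pres_congr_refl u : pres_congr u u
| pres_congr_sym u v of pres_congr u v : pres_congr v u
| pres_congr_trans u v w of pres_congr u v & pres_congr v w : pres_congr u w
| pres_congr_cat u u' v v' of pres_congr u u' & pres_congr v v' :
    pres_congr (u ++ v) (u' ++ v').

Definition pres_congrb : rel (seq X) := fun u v => `[< pres_congr u v >].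

Lemma pres_congrb_refl : reflexive pres_congrb.
Proof. by move=> u; apply/asboolP/pres_congr_refl. Qed.

Lemma pres_congrb_sym : symmetric pres_congrb.
Proof. by move=> u v; apply/asboolP/asboolP => /pres_congr_sym. Qed.

Lemma pres_congrb_trans : transitive pres_congrb.
Proof.
by move=> v u w /asboolP uv /asboolP vw; apply/asboolP/(pres_congr_trans uv).
Qed.

Canonical pres_equiv :=
  EquivRel pres_congrb pres_congrb_refl pres_congrb_sym pres_congrb_trans.

Definition pres_monoid : Type := {eq_quot pres_equiv}.
HB.instance Definition _ := Choice.on pres_monoid.
HB.instance Definition _ := EqQuotient.on pres_monoid.

Definition pres_class (u : seq X) : pres_monoid := \pi_pres_monoid u.

Lemma pres_classP u v : pres_class u = pres_class v <-> pres_congr u v.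
Proof.
by split => [/eqquotP/asboolP //|uv]; apply/eqquotP/asboolP.
Qed.

Lemma pres_class_repr (m : pres_monoid) : pres_class (repr m) = m.
Proof. exact: reprK. Qed.

Lemma pres_repr_class u : pres_congr (repr (pres_class u)) u.
Proof. by apply/pres_classP; rewrite pres_class_repr. Qed.

Definition pres_one : pres_monoid := pres_class [::].
Definition pres_mul (a b : pres_monoid) : pres_monoid :=
  pres_class (repr a ++ repr b).

Lemma pres_mul_class u v :
  pres_mul (pres_class u) (pres_class v) = pres_class (u ++ v).
Proof. by apply/pres_classP/pres_congr_cat; apply: pres_repr_class. Qed.

Lemma pres_mulA : associative pres_mul.
Proof.
move=> a b c; rewrite -[a]pres_class_repr -[b]pres_class_repr.
by rewrite -[c]pres_class_repr !pres_mul_class catA.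
Qed.

Lemma pres_1mul : left_id pres_one pres_mul.
Proof. by move=> a; rewrite -[a]pres_class_repr pres_mul_class. Qed.

Lemma pres_mul1 : right_id pres_one pres_mul.
Proof. by move=> a; rewrite -[a]pres_class_repr pres_mul_class cats0. Qed.

HB.instance Definition _ :=
  isMonoid.Build pres_monoid pres_mulA pres_1mul pres_mul1.

Definition pres_gen (x : X) : pres_monoid := pres_class [:: x].

Section Lift.
Local Open Scope group_scope.
Context {M : monoidType} (f : X -> M).
Context (fR : forall u v, R u v -> \prod_(x <- u) f x = \prod_(x <- v) f x).

Lemma pres_congr_prod u v :
  pres_congr u v -> \prod_(x <- u) f x = \prod_(x <- v) f x.
Proof.
by elim=> // {u v} => [u v w _ -> _ ->|u u' v v' _ eu _ ev] //;
  rewrite !big_cat /= eu ev.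
Qed.

(* By fR the value does not depend on the representative repr m, and          *)
(* pres_lift is the monoid morphism that extends f.                           *)
Definition pres_lift (m : pres_monoid) : M := \prod_(x <- repr m) f x.

Lemma pres_lift_class u : pres_lift (pres_class u) = \prod_(x <- u) f x.
Proof. exact/pres_congr_prod/pres_repr_class. Qed.

Lemma pres_lift_gen x : pres_lift (pres_gen x) = f x.
Proof. by rewrite pres_lift_class big_seq1. Qed.

Lemma pres_lift1 : pres_lift 1 = 1.
Proof. by rewrite pres_lift_class big_nil. Qed.

Lemma pres_liftM : {morph pres_lift : a b / a * b}.
Proof.
move=> a b; rewrite -[a]pres_class_repr -[b]pres_class_repr.
by rewrite [_ * _]pres_mul_class !pres_lift_class big_cat.
Qed.

End Lift.
End MonoidPresentation.

(* The letters of a group presentation are pairs (x, b), which stand for      *)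
(* x if b = false and for the formal inverse of x if b = true.                *)
Section GroupPresentation.
Context {X : choiceType} (R : seq (X * bool) -> seq (X * bool) -> Prop).

Inductive grp_rel : seq (X * bool) -> seq (X * bool) -> Prop :=
| grp_rel_cancel x b : grp_rel [:: (x, b); (x, ~~ b)] [::]
| grp_rel_of u v of R u v : grp_rel u v.

Definition pres_group : Type := pres_monoid grp_rel.
HB.instance Definition _ := Monoid.on pres_group.

Definition word_inv (u : seq (X * bool)) : seq (X * bool) :=
  rev [seq (p.1, ~~ p.2) | p <- u].

Lemma word_invK : involutive word_inv.
Proof.
move=> u; rewrite /word_inv map_rev revK -map_comp.
by rewrite map_id_in // => -[x b] _ /=; rewrite negbK.
Qed.

Lemma word_mulV u : pres_congr grp_rel (u ++ word_inv u) [::].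
Proof.
elim: u => [|[x b] u IHu]; first exact: pres_congr_refl.
rewrite /word_inv map_cons rev_cons -cats1 -cat1s -catA catA.
rewrite -/(word_inv u) -[[::]]/([::] ++ [::] : seq (X * bool)) catA.
apply: (@pres_congr_trans _ _ _ ([:: (x, b)] ++ [:: (x, ~~ b)])); last first.
  exact/pres_congr_rel/grp_rel_cancel.
apply: pres_congr_cat; last exact: pres_congr_refl.
rewrite -[in X in pres_congr _ _ X](cats0 [:: (x, b)]) -catA.
by apply: pres_congr_cat; [exact: pres_congr_refl|].
Qed.

Definition pres_inv (a : pres_group) : pres_group :=
  pres_class grp_rel (word_inv (repr a)).

Local Open Scope group_scope.

Lemma pres_mulV : right_inverse (1 : pres_group) pres_inv ( *%g : pres_group -> _).
Proof.
move=> a; rewrite -[X in X * _](pres_class_repr a) [LHS]pres_mul_class.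
exact/pres_classP/word_mulV.
Qed.

Lemma pres_Vmul : left_inverse (1 : pres_group) pres_inv ( *%g : pres_group -> _).
Proof.
move=> a; rewrite -[X in _ * X](pres_class_repr a) [LHS]pres_mul_class.
by apply/pres_classP; rewrite -[X in _ ++ X]word_invK; apply: word_mulV.
Qed.

HB.instance Definition _ := hasInv.Build pres_group pres_inv.
HB.instance Definition _ := Monoid_isGroup.Build pres_group pres_Vmul pres_mulV.

End GroupPresentation.

Record sgraph := SGraph {
  vertex : choiceType;
  edge : rel vertex;
  edge_sym : symmetric edge;
  edge_irr : irreflexive edge
}.

Inductive graph_rel (Gamma : sgraph) :
    seq (vertex Gamma) -> seq (vertex Gamma) -> Prop :=
| GraphRel x y of edge x y : graph_rel [:: x; y] [:: y; x].

Definition graph_monoid (Gamma : sgraph) : Type := pres_monoid (@graph_rel Gamma).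
HB.instance Definition _ (Gamma : sgraph) := Monoid.on (graph_monoid Gamma).

(* The generator sigma_(i+1) of the braid group on n strings is represented   *)
(* by the index i : 'I_n.-1.                                                  *)
Inductive braid_rel (n : nat) :
    seq ('I_n.-1 * bool) -> seq ('I_n.-1 * bool) -> Prop :=
| braid_far (j k : 'I_n.-1) of (1 < `|j - k|)%N :
    braid_rel [:: (j, false); (k, false)] [:: (k, false); (j, false)]
| braid_near (j k : 'I_n.-1) of `|j - k|%N = 1%N :
    braid_rel [:: (j, false); (k, false); (j, false)]
              [:: (k, false); (j, false); (k, false)].

Definition braid (n : nat) : Type := pres_group (@braid_rel n).
HB.instance Definition _ (n : nat) := Group.on (braid n).

Definition sigma (n : nat) (i : 'I_n.-1) : braid n :=
  pres_gen (grp_rel (@braid_rel n)) (i, false).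

(* The additive group of Z[G] is monalg's free abelian group on G; the        *)
(* product is defined here because the ring structure of monalg is restricted *)
(* to monoids without nontrivial units.                                       *)
Definition group_ring (G : groupType) : Type := {malg int[G]}.
HB.instance Definition _ (G : groupType) := GRing.Zmodule.on (group_ring G).

Section GroupRing.
Local Open Scope ring_scope.
Context {G : groupType}.
Implicit Types (x y z : group_ring G) (g h : G).

Definition gr_of (g : G) : group_ring G := << g >>.

Definition gr_mul x y : group_ring G :=
  \sum_(g <- msupp x) \sum_(h <- msupp y) << x@_g * y@_h *g (g * h)%g >>.

Local Open Scope fset_scope.

Lemma gr_mulw (d1 d2 : {fset G}) x y : msupp x `<=` d1 -> msupp y `<=` d2 ->
  gr_mul x y = \sum_(g <- d1) \sum_(h <- d2) << x@_g * y@_h *g (g * h)%g >>.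
Proof.
move=> le1 le2; rewrite /gr_mul (big_fset_incl _ le1) /=.
  apply/eq_bigr=> g _; apply/big_fset_incl => // h _ /mcoeff_outdom ->.
  by rewrite mulr0 monalgU0.
move=> g _ /mcoeff_outdom xg.
by rewrite big1 => // h _; rewrite xg mul0r monalgU0.
Qed.

Lemma gr_mulDl : left_distributive gr_mul +%R.
Proof.
move=> x y z.
rewrite (@gr_mulw (msupp x `|` msupp y) (msupp z) x) ?fsubsetUl //.
rewrite (@gr_mulw (msupp x `|` msupp y) (msupp z) y) ?fsubsetUr //.
rewrite (@gr_mulw (msupp x `|` msupp y) (msupp z)) ?msuppD_le //.
rewrite -big_split /=; apply/eq_bigr=> g _.
rewrite -big_split /=; apply/eq_bigr=> h _.
by rewrite mcoeffD mulrDl monalgUD.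
Qed.

Lemma gr_mulDr : right_distributive gr_mul +%R.
Proof.
move=> z x y.
rewrite (@gr_mulw (msupp z) (msupp x `|` msupp y) z x) ?fsubsetUl //.
rewrite (@gr_mulw (msupp z) (msupp x `|` msupp y) z y) ?fsubsetUr //.
rewrite (@gr_mulw (msupp z) (msupp x `|` msupp y)) ?msuppD_le //.
rewrite -big_split /=; apply/eq_bigr=> g _.
rewrite -big_split /=; apply/eq_bigr=> h _.
by rewrite mcoeffD mulrDr monalgUD.
Qed.

Lemma gr_mulUU (a b : int) g h :
  gr_mul << a *g g >> << b *g h >> = << a * b *g (g * h)%g >>.
Proof.
by rewrite (@gr_mulw [fset g] [fset h]) ?msuppU_le // !big_seq_fset1 !mcoeffUU.
Qed.

Lemma gr_mul0l z : gr_mul 0 z = 0.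
Proof. by apply: (addIr (gr_mul 0 z)); rewrite -gr_mulDl !add0r. Qed.

Lemma gr_mul0r z : gr_mul z 0 = 0.
Proof. by apply: (addIr (gr_mul z 0)); rewrite -gr_mulDr !add0r. Qed.

Lemma gr_mul_suml I (s : seq I) (F : I -> group_ring G) z :
  gr_mul (\sum_(i <- s) F i) z = \sum_(i <- s) gr_mul (F i) z.
Proof.
exact: (big_morph (gr_mul^~ z) (fun x y => gr_mulDl x y z) (gr_mul0l z)).
Qed.

Lemma gr_mul_sumr I (s : seq I) (F : I -> group_ring G) z :
  gr_mul z (\sum_(i <- s) F i) = \sum_(i <- s) gr_mul z (F i).
Proof. exact: (big_morph (gr_mul z) (gr_mulDr z) (gr_mul0r z)). Qed.

Lemma gr_decomp x :
  exists s : seq (int * G), x = \sum_(p <- s) << p.1 *g p.2 >>.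
Proof.
exists [seq (x@_g, g) | g <- msupp x].
by rewrite big_map [LHS]monalgE.
Qed.

Lemma gr_mulA : associative gr_mul.
Proof.
move=> x y z; have [s ->] := gr_decomp x.
rewrite (gr_mul_suml s _ y) 2!(gr_mul_suml s); apply/eq_bigr => -[a g] _ /=.
have [t ->] := gr_decomp y.
rewrite (gr_mul_suml t) 2!(gr_mul_sumr t) (gr_mul_suml t).
apply/eq_bigr => -[b h] _ /=; have [w ->] := gr_decomp z.
rewrite 3!(gr_mul_sumr w); apply/eq_bigr => -[c k] _ /=.
by rewrite !gr_mulUU mulrA mulgA.
Qed.

Lemma gr_mul1l : left_id (gr_of 1%g) gr_mul.
Proof.
move=> x; rewrite {1}(monalgE x) gr_mul_sumr [RHS]monalgE.
by apply/eq_bigr => g _; rewrite gr_mulUU mul1r mul1g.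
Qed.

Lemma gr_mul1r : right_id (gr_of 1%g) gr_mul.
Proof.
move=> x; rewrite {1}(monalgE x) gr_mul_suml [RHS]monalgE.
by apply/eq_bigr => g _; rewrite gr_mulUU mulr1 mulg1.
Qed.

Lemma gr_one_neq0 : gr_of 1%g != 0.
Proof. by rewrite monalgU_eq0. Qed.

HB.instance Definition _ := GRing.Zmodule_isNzRing.Build (group_ring G)
  gr_mulA gr_mul1l gr_mul1r gr_mulDl gr_mulDr gr_one_neq0.

Lemma gr_of1 : gr_of 1%g = 1.
Proof. by []. Qed.

Lemma gr_ofM : {morph gr_of : g h / (g * h)%g >-> g * h}.
Proof. by move=> g h; rewrite -[RHS]/(gr_mul _ _) gr_mulUU mulr1. Qed.

Lemma gr_sub1C g h : (g * h)%g = (h * g)%g ->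
  (gr_of g - 1) * (gr_of h - 1) = (gr_of h - 1) * (gr_of g - 1).
Proof.
move=> gh; have cgh : GRing.comm (gr_of g) (gr_of h).
  by rewrite /GRing.comm -!gr_ofM gh.
apply: commrB; last exact: commr1.
by apply/commr_sym/commrB; [exact/commr_sym|exact: commr1].
Qed.

End GroupRing.

Definition mult_monoid (R : nzRingType) : Type := R.
HB.instance Definition _ (R : nzRingType) := Choice.on (mult_monoid R).
HB.instance Definition _ (R : nzRingType) :=
  isMonoid.Build (mult_monoid R) (@mulrA R) (@mul1r R) (@mulr1 R).

Section Omega.
Context (n : nat).

Definition in_Upsilon : {pred braid n} := fun g =>
  `[< exists (a : braid n) (i : 'I_n.-1), g = (a * sigma i ^+ 2 * a^-1)%g >].

Definition Upsilon : Type := {g : braid n | in_Upsilon g}.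
HB.instance Definition _ := Choice.on Upsilon.

Definition Omega_edge : rel Upsilon := fun u v =>
  (u != v) && ((val u * val v)%g == (val v * val u)%g).

Lemma Omega_edge_sym : symmetric Omega_edge.
Proof.
by move=> u v; rewrite /Omega_edge eq_sym [X in _ && X]eq_sym.
Qed.

Lemma Omega_edge_irr : irreflexive Omega_edge.
Proof. by move=> u; rewrite /Omega_edge eqxx. Qed.

Definition Omega : sgraph := SGraph Omega_edge_sym Omega_edge_irr.

Definition nu_gen (u : Upsilon) : mult_monoid (group_ring (braid n)) :=
  (gr_of (val u) - 1)%R.

Definition nu : graph_monoid Omega -> mult_monoid (group_ring (braid n)) :=
  pres_lift nu_gen.

Lemma nu_gen_rel (s t : seq Upsilon) : @graph_rel Omega s t ->
  (\prod_(u <- s) nu_gen u)%g = (\prod_(u <- t) nu_gen u)%g.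
Proof.
case=> u v /andP[_ /eqP uv]; rewrite !big_cons big_nil !mulg1.
exact: gr_sub1C.
Qed.

Lemma nu_is_monoid_morphism : monoid.monoid_morphism nu.
Proof. by split; [exact: pres_lift1 nu_gen_rel|exact: pres_liftM nu_gen_rel]. Qed.

HB.instance Definition _ :=
  isUMagmaMorphism.Build _ _ nu nu_is_monoid_morphism.

Lemma nu_genE (u : Upsilon) :
  nu (pres_gen (@graph_rel Omega) u) = (gr_of (val u) - 1)%R.
Proof. exact: pres_lift_gen nu_gen_rel u. Qed.

End Omega.

Arguments nu n : clear implicits.

(* Main.v *)
From HB Require Import structures.
Require Import Defs.
From mathcomp Require Import all_boot.
From mathcomp Require Import all_algebra finmap boolp zify.
From mathcomp.multinomials Require Import monalg.

Set Implicit Arguments.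
Unset Strict Implicit.
Unset Printing Implicit Defensive.

Import GRing.Theory Num.Theory.

(** The product (u1 - 1) ... (uk - 1) can be decoded letter by letter because
any two distinct elements u, v of Upsilon are as independent as possible:
either they commute and no nontrivial power of one is a power of the other, or
they play ping-pong on some set, so that they generate a free group.

Decoding.  For h in Z[G] consider the sums of the coefficients of h over the
cosets <u>g.  They all vanish when h lies in (u - 1)Z[G].  Suppose that they
vanish for h = (c1 - 1) ... (cm - 1).  If c1 commutes with u, the sums for the
product of the other factors are constant along the orbits of c1; these orbits
are infinite and the support is finite, so the sums vanish, and one passes on to
c2 ([csum_indep]).  If c1 and u play ping-pong, then every point of the support
of h shares its <u>-coset and its <c1>-coset with another point of the support;
following such points alternately in a finite set produces a nontrivial
alternating word that equals 1, a contradiction ([csum_pingpong]).  Hence u is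
one of the ci and commutes with all the letters before it, so it can be moved to
the front and cancelled ([csum_prod_find], [prod_sub1_inj]).

Pairs of elements of Upsilon.  All these elements are conjugate, so u may be
taken to be the square of the first generator, a full twist of strings 0 and 1.
Combing string 0 ([comb]) shows that, up to a conjugation by a braid that fixes
string 0, the element v is either a full twist [push j] of string 0 with another
one, or the square of a generator that does not move string 0; under this
conjugation u becomes a conjugate of some [push x] by a product of pushes
([fix0_conj]).

To recognize ping-pong, the braid group acts on pairs made of a string and an
element of a free group, by the Artin automorphisms ([act]).  Over string 0, and
after the generator of that string has been killed, each [push k] acts as the
left multiplication by a letter, while the square of a generator acts as the
automorphism that conjugates two of the letters by their product.  In both cases
there is a letter z of a well-chosen basis such that v changes by 1 the exponent
of z at the beginning of a reduced word, provided that the letter after this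
power of z belongs to a certain set Y, and such that v commutes with the elements
of the basis outside Y.  Write u as the conjugate of a letter x by a word w and
take w as short as possible.  Then w does not end with a letter outside Y, which
could be removed by a conjugation that does not change v.  If w is empty and x is
outside Y, then u commutes with v.  Otherwise the reduced words of the nontrivial
powers of u begin and end with letters in Y, and u and v play ping-pong with the
words that begin with a letter in Y and those that begin with a nontrivial power
of z followed by a letter in Y ([pingpong_conj], [conj_dichotomy]). *)

(** * Powers of an element and independent pairs *)

Lemma pigeonhole_seq (T : eqType) (s : seq T) (f : nat -> T) :
  (forall k, f k \in s) -> exists i d, f i = f (i + d.+1).
Proof.
move=> fs; have : ~~ uniq (map f (iota 0 (size s).+1)).
  apply/negP => un; have : size (map f (iota 0 (size s).+1)) <= size s.
    by apply: uniq_leq_size => // x /mapP[k _ ->].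
  by rewrite size_map size_iota ltnn.
case/(uniqPn (f 0)) => i [j]; rewrite size_map size_iota => -[ij js].
rewrite !(nth_map 0) ?size_iota ?(ltn_trans ij) // !nth_iota ?(ltn_trans ij) //.
move=> e; exists i, (j - i).-1.
by rewrite prednK ?subn_gt0 // subnKC // ltnW.
Qed.

Section Powers.
Local Open Scope group_scope.
Context {G : groupType}.
Implicit Types u v x y : G.

Definition powers u x : Prop := exists k, x = u ^+ k \/ x = u ^- k.

Lemma powersV u x : powers u x -> powers u x^-1.
Proof. by case=> k [->|->]; exists k; [right|left; rewrite invgK]. Qed.

Lemma powersX u k : powers u (u ^+ k).
Proof. by exists k; left. Qed.

Lemma powers1 u : powers u 1.
Proof. exact: (powersX u 0). Qed.

Lemma powersM u x y : powers u x -> powers u y -> powers u (x * y).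
Proof.
have XV k l : powers u (u ^+ k * u ^- l).
  case: (leqP l k) => [lk|/ltnW kl].
    by exists (k - l); left; rewrite expgnFr.
  by exists (l - k); right; rewrite expgnFr // invgF.
have cV k l : u ^- k * u ^+ l = u ^+ l * u ^- k.
  by apply/commute_sym/commuteV/commuteX2.
case=> k [->|->] [l [->|->]].
- by exists (k + l); left; rewrite expgnDr.
- exact: XV.
- by rewrite cV; apply: XV.
- by exists (l + k); right; rewrite expgnDr invgM.
Qed.

Lemma powers_commute u v x : commute v u -> powers u x -> commute v x.
Proof.
move=> vu [k [->|->]]; first exact: commuteX.
exact/commuteV/commuteX.
Qed.

Lemma powers_conj u v x : commute v u -> powers u (v * x * v^-1) <-> powers u x.
Proof.
move=> vu; split=> [p|p].
  have := powers_commute vu p; rewrite /commute mulgVK => /mulgI <-.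
  exact: p.
by rewrite (powers_commute vu p) mulgK.
Qed.

Definition indep u v := forall k, ~ powers u (v ^+ k.+1).

Definition inf_order u := forall k, u ^+ k.+1 <> 1.

Lemma inf_order_indep u : inf_order u -> indep 1 u.
Proof. by move=> ou k [l [|]]; rewrite expg1n ?invg1; apply: ou. Qed.

Lemma inf_order_sqr u x : inf_order u -> powers u x -> x <> 1 -> x * x <> 1.
Proof.
move=> ou; have XX k : u ^+ k <> 1 -> u ^+ k * u ^+ k <> 1.
  by case: k => [|k] // _; rewrite -expgnDr addnS; apply: ou.
case=> k [->|->]; first exact: XX.
by rewrite -invgM => h /eqP; rewrite invg_eq1 => /eqP; apply: XX => h1;
   apply: h; rewrite h1 invg1.
Qed.

(** The conditions of the ping-pong lemma for the cyclic groups generated by u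
and v. *)
Definition pingpong u v := exists (W : Type) (a : G -> W -> W) (Xu Xv : W -> Prop),
  [/\ (forall w, a 1 w = w) /\ (forall g h w, a (g * h) w = a g (a h w)),
      exists w, Xv w, forall w, Xu w -> ~ Xv w,
      forall x w, powers u x -> x <> 1 -> Xv w -> Xu (a x w) &
      forall x w, powers v x -> x <> 1 -> Xu w -> Xv (a x w)].

Definition dichotomy u v := (commute u v /\ indep u v) \/ pingpong u v.

End Powers.

(** * Sums of coefficients over cosets of a cyclic group *)
Section CosetSum.
Local Open Scope ring_scope.
Context {G : groupType}.
Implicit Types (u v x g : G) (h a b : group_ring G).

Let powb u x : bool := `[< powers u x >].

Definition csum u g h : int :=
  \sum_(x <- msupp h) h@_x *+ powb u (x * g^-1)%g.

Lemma csum_supp u g h (d : {fset G}) : (msupp h `<=` d)%fset ->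
  csum u g h = \sum_(x <- d) h@_x *+ powb u (x * g^-1)%g.
Proof.
move=> hd; apply: big_fset_incl => // x _ /mcoeff_outdom ->.
by rewrite mul0rn.
Qed.

Lemma csumD u g h h' : csum u g (h + h') = csum u g h + csum u g h'.
Proof.
rewrite (@csum_supp u g h ((msupp h `|` msupp h')%fset)) ?fsubsetUl //.
rewrite (@csum_supp u g h' ((msupp h `|` msupp h')%fset)) ?fsubsetUr //.
rewrite (@csum_supp u g _ ((msupp h `|` msupp h')%fset)) ?msuppD_le //.
by rewrite -big_split /=; apply: eq_bigr => x _; rewrite mcoeffD mulrnDl.
Qed.

Lemma csum0 u g : csum u g 0 = 0.
Proof. by apply: (@addIr _ (csum u g 0)); rewrite -csumD !add0r. Qed.

Lemma csumB u g h h' : csum u g (h - h') = csum u g h - csum u g h'.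
Proof. by apply/eqP; rewrite eq_sym subr_eq -csumD subrK. Qed.

Lemma csum_sum u g I (s : seq I) (F : I -> group_ring G) :
  csum u g (\sum_(i <- s) F i) = \sum_(i <- s) csum u g (F i).
Proof. exact: (big_morph (csum u g) (csumD u g) (csum0 u g)). Qed.

Lemma csumU u g c x : csum u g << c *g x >> = c *+ powb u (x * g^-1)%g.
Proof.
by rewrite (@csum_supp u g _ [fset x]%fset) ?msuppU_le // big_seq_fset1 mcoeffUU.
Qed.

(** Left multiplication by v permutes the cosets of <u> because v centralizes
it. *)
Lemma csum_mul u g v h :
  commute v u -> csum u g (gr_of v * h) = csum u (v^-1 * g)%g h.
Proof.
move=> vu; have [s ->] := gr_decomp h.
rewrite [_ * _]gr_mul_sumr !csum_sum; apply: eq_bigr => -[c x] _ /=.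
rewrite gr_mulUU mul1r !csumU; congr (_ *+ nat_of_bool _).
have -> : (v * x * g^-1 = v * (x * (v^-1 * g)^-1) * v^-1)%g.
  by rewrite invgM invgK !mulgA mulgK.
by apply: asbool_equiv_eq; apply: powers_conj.
Qed.

Lemma csum_coset u g x h : powers u x -> csum u (x * g)%g h = csum u g h.
Proof.
move=> ux; apply: eq_bigr => y _; congr (_ *+ nat_of_bool _).
apply: asbool_equiv_eq; rewrite invgM mulgA; split=> p.
  by rewrite -(mulgVK x (_ * _)%g); apply: powersM.
by apply: powersM => //; apply: powersV.
Qed.

Lemma csum_sub1 u g h : csum u g ((gr_of u - 1) * h) = 0.
Proof.
rewrite mulrBl mul1r csumB csum_mul // csum_coset ?subrr //.
exact/powersV/(powersX u 1).
Qed.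

Lemma csum_trivial g h : csum 1%g g h = h@_g.
Proof.
have [s ->] := gr_decomp h; rewrite csum_sum raddf_sum /=.
apply: eq_bigr => -[c x] _ /=; rewrite csumU mcoeffU.
congr (_ *+ nat_of_bool _); apply/asboolP/eqP => [[k]|->].
  rewrite expg1n invg1 => -[] e; exact: divg1_eq.
by rewrite mulgV; apply: powers1.
Qed.

Lemma csum_neq0 u g h : csum u g h != 0 ->
  exists2 x, x \in msupp h & powers u (x * g^-1)%g.
Proof.
move=> nz; apply: contrapT => no; case/eqP: nz.
rewrite /csum big_seq big1 // => x xh.
rewrite /powb; case: asboolP => //= px; case: no; by exists x.
Qed.

Lemma csum_other u g h : csum u g h = 0 -> g \in msupp h ->
  exists x, [/\ x \in msupp h, x <> g & powers u (x * g^-1)%g].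
Proof.
move=> s0 gh; apply: contrapT => no.
move: s0; rewrite /csum (big_fsetD1 g) //= mulgV.
have -> : powb u 1 by apply/asboolP/powers1.
rewrite big_seq big1 ?addr0 => [/eqP|x]; first by rewrite mcoeff_eq0 gh.
rewrite !inE => /andP[/eqP xg xh]; rewrite /powb; case: asboolP => //= px.
by case: no; exists x.
Qed.

(** The sums over the cosets <u>v^(-k)g do not depend on k.  These cosets are
pairwise distinct since u and v are independent, and only finitely many of them
meet the support of h. *)
Lemma csum_indep u v h : commute v u -> indep u v ->
  (forall g, csum u g ((gr_of v - 1) * h) = 0) -> forall g, csum u g h = 0.
Proof.
move=> vu uv h0 g; apply/eqP/negPn/negP => nz.
have step g' : csum u (v^-1 * g')%g h = csum u g' h.
  by apply/eqP; have := h0 g'; rewrite mulrBl mul1r csumB csum_mul // -subr_eq0 => ->.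
have steps k : csum u (v ^- k * g)%g h = csum u g h.
  elim: k => [|k IHk]; first by rewrite expg0 invg1 mul1g.
  by rewrite expgSr invgM -mulgA step.
have /choice[f fP] k : exists x, x \in msupp h /\ powers u (x * (v ^- k * g)^-1)%g.
  have := nz; rewrite -(steps k) => /csum_neq0[x xh px]; by exists x.
have [i [d e]] := @pigeonhole_seq _ _ f (fun k => proj1 (fP k)).
have [_ pi] := fP i; have [_ pj] := fP (i + d.+1); rewrite -e in pj.
case: (uv d); have := powersM (powersV pi) pj.
by rewrite !invgM !invgK expgnDr !mulgA !(mulgVK, mulgK) mulVg mul1g.
Qed.

(** The two vanishing conditions allow an endless walk in the support of h whose
steps are alternately left multiplications by nontrivial powers of u and of v.
The support is finite, so the walk comes back to a previous point, whereas a
nontrivial alternating word acts nontrivially by ping-pong. *)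
Lemma csum_pingpong u v h : inf_order u -> pingpong u v ->
  (forall g, csum u g h = 0) -> (forall g, csum v g h = 0) -> h = 0.
Proof.
move=> ou [W [a [Xu [Xv [[a1 aM] [p Xvp] Xuv stepu stepv]]]]] hu hv.
apply/malgP => x0; rewrite mcoeff0; apply/eqP; rewrite mcoeff_eq0.
apply/negP => x0h.
have next w : (forall g, csum w g h = 0) -> exists f, forall g, g \in msupp h ->
    [/\ f g \in msupp h, f g <> g & powers w (f g * g^-1)%g].
  move=> hw; have /choice[f fP] g : exists y, g \in msupp h ->
      [/\ y \in msupp h, y <> g & powers w (y * g^-1)%g].
    case: (boolP (g \in msupp h)) => gh; last by exists g.
    by have [y yP] := csum_other (hw g) gh; exists y.
  by exists f.
have [fu fuP] := next u hu; have [fv fvP] := next v hv.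
pose z k := iter k (fv \o fu) x0.
have zh k : z k \in msupp h.
  elim: k => [|k IHk] //=; have [h1 _ _] := fuP _ IHk.
  by have [h2 _ _] := fvP _ h1.
have neq1 (y g : G) : y <> g -> (y * g^-1 <> 1)%g.
  by move=> yg /eqP; rewrite divg_eq1 => /eqP.
(* The walk visits z 0, z 1, ... after each pair of steps; the power x of u is
   isolated because y alone, which begins and ends with powers of v, maps Xu to
   Xv. *)
have word1 k : exists y x, [/\ z k.+1 = y * x * z k, powers u x, x <> 1 &
    forall q, Xu q -> Xv (a y q)]%g.
  have [h1 n1 p1] := fuP _ (zh k); have [_ n2 p2] := fvP _ h1.
  exists (fv (fu (z k)) * (fu (z k))^-1)%g, (fu (z k) * (z k)^-1)%g.
  split=> // [|| q]; [by rewrite mulgA !mulgVK|exact: neq1|].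
  by apply: stepv => //; apply: neq1.
have word i d : exists y x, [/\ z (i + d.+1)%N = y * x * z i, powers u x, x <> 1 &
    forall q, Xu q -> Xv (a y q)]%g.
  elim: d => [|d [y [x [e xu x1 yP]]]]; first by rewrite addn1; apply: word1.
  have [y' [x' [e' xu' x1' yP']]] := word1 (i + d.+1)%N.
  exists (y' * x' * y)%g, x; split=> //; first by rewrite addnS e' e !mulgA.
  by move=> q /yP q1; rewrite !aM; apply/yP'/stepu.
have [i [d e]] := pigeonhole_seq zh.
have [y [x [eyx xu x1 yP]]] := word i d.
have yV : y = (x^-1)%g.
  by apply/eqP; rewrite -mulg_eq1; apply/eqP/(mulIg (z i)); rewrite mul1g -eyx.
have xV1 : (x^-1 <> 1)%g by move/eqP; rewrite invg_eq1 => /eqP.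
have xVu := powersV xu.
(* The closed walk gives y = x^-1; then x^-1 * x^-1 maps p both to Xv and, as a
   nontrivial power of u, to Xu. *)
have := yP _ (stepu _ _ xVu xV1 Xvp); rewrite yV -aM.
apply: Xuv; apply: stepu => //; first exact: powersM.
exact: inf_order_sqr xVu xV1.
Qed.

End CosetSum.

(** * Decoding products of the elements u - 1 *)
Section TraceEmbedding.
Local Open Scope ring_scope.
Context {G : groupType} {T : choiceType} (f : T -> G).
Context (R : seq T -> seq T -> Prop).

Hypothesis f_order : forall x, inf_order (f x).
Hypothesis f_pair : forall x y, x <> y -> dichotomy (f x) (f y).
Hypothesis f_rel : forall x y, x <> y -> commute (f x) (f y) ->
  R [:: x; y] [:: y; x].

Let F x : group_ring G := gr_of (f x) - 1.
Let P s : group_ring G := \prod_(x <- s) F x.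

(** The case of the trivial group in [csum_indep]: its cosets are points. *)
Lemma sub1_eq0 u (h : group_ring G) :
  inf_order u -> (gr_of u - 1) * h = 0 -> h = 0.
Proof.
move=> ou e; apply/malgP => g; rewrite mcoeff0 -csum_trivial.
apply: (csum_indep (v := u)) => [||g']; first exact: commute1.
  exact: inf_order_indep.
by rewrite e csum0.
Qed.

Lemma prod_sub1_neq0 s : P s <> 0.
Proof.
rewrite /P; elim: s => [|x s IHs]; first by rewrite big_nil => /eqP; rewrite oner_eq0.
by rewrite big_cons => /(sub1_eq0 (@f_order x)).
Qed.

(** If x divides a product on the left, in the weak sense that the coset sums of
the product vanish, then x is a letter of the word and can be moved to the
front. *)
Lemma csum_prod_find x s : (forall g, csum (f x) g (P s) = 0) ->
  exists2 s', pres_congr R s (x :: s') & P s = F x * P s'.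
Proof.
have cPl y s' : P (y :: s') = F y * P s' by rewrite /P big_cons.
elim: s => [/(_ 1%g)|y s IHs].
  rewrite /P big_nil -gr_of1 csumU mulgV.
  by case: asboolP => // -[]; apply: powers1.
case: (eqVneq y x) => [->|/eqP yx] hs.
  by exists s; [apply: pres_congr_refl|].
have hxy := f_pair (nesym yx).
case: hxy => [[cxy ixy]|pp].
  have [g|s' es eP] := IHs.
    by apply: (csum_indep (v := f y)) => // g'; rewrite -cPl.
  exists (y :: s').
    apply: (@pres_congr_trans _ _ _ (y :: x :: s')).
      rewrite -cat1s -[y :: x :: _]cat1s.
      by apply: pres_congr_cat; [apply: pres_congr_refl|].
    rewrite -[y :: x :: _]/([:: y; x] ++ s') -[x :: y :: _]/([:: x; y] ++ s').
    apply: pres_congr_cat; last exact: pres_congr_refl.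
    by apply/pres_congr_rel/f_rel => //; apply: commute_sym.
  by rewrite !cPl eP !mulrA; congr (_ * _); apply: gr_sub1C.
case: (@prod_sub1_neq0 (y :: s)).
apply: (csum_pingpong (@f_order x) pp) => // g.
by rewrite cPl csum_sub1.
Qed.

Lemma prod_sub1_inj s t : P s = P t -> pres_congr R s t.
Proof.
elim: s t => [|x s IHs] t est; last first.
  have [g|t' ct eP] := @csum_prod_find x t.
    by rewrite -est /P big_cons csum_sub1.
  apply: pres_congr_trans (pres_congr_sym ct).
  rewrite -cat1s -[x :: t']cat1s.
  apply: pres_congr_cat; first exact: pres_congr_refl.
  apply: IHs; apply/eqP; rewrite -subr_eq0; apply/eqP/(sub1_eq0 (@f_order x)).
  by rewrite mulrBr -/(F x) -eP -est /P big_cons subrr.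
case: t est => [|x t] est; first exact: pres_congr_refl.
have := csum_sub1 (f x) 1%g (P t).
have -> : (gr_of (f x) - 1) * P t = P [::] by rewrite est /P big_cons.
rewrite /P big_nil -gr_of1 csumU mulgV.
by case: asboolP => // -[]; apply: powers1.
Qed.

End TraceEmbedding.

(** * Conjugation of pairs *)
Section Conjugation.
Local Open Scope group_scope.
Context {G : groupType}.
Implicit Types u v x g : G.

Lemma powers_conjg u x g : powers u x -> powers (u ^ g) (x ^ g).
Proof.
by case=> k [->|->]; exists k; [left|right]; rewrite ?conjVg conjXg.
Qed.

Lemma indep_conjg u v g : indep u v -> indep (u ^ g) (v ^ g).
Proof.
move=> uv k /(powers_conjg (g^-1)); rewrite -conjXg !conjgK; exact: uv.
Qed.

Lemma inf_order_conjg u g : inf_order u -> inf_order (u ^ g).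
Proof.
by move=> ou k /eqP; rewrite -conjXg conjg_eq1 => /eqP; apply: ou.
Qed.

Lemma pingpong_conjg u v g : pingpong u v -> pingpong (u ^ g) (v ^ g).
Proof.
case=> W [a [Xu [Xv [[a1 aM] ne Xuv stepu stepv]]]].
exists W, (fun x => a (x ^ g^-1)), Xu, Xv; split=> //.
- by split=> [w|x y w]; rewrite ?conj1g ?conjMg.
- move=> x w /(powers_conjg (g^-1)); rewrite conjgK => px x1.
  by apply: stepu => // /eqP; rewrite conjg_eq1 => /eqP.
- move=> x w /(powers_conjg (g^-1)); rewrite conjgK => px x1.
  by apply: stepv => // /eqP; rewrite conjg_eq1 => /eqP.
Qed.

Definition eq_or_dichotomy u v := u = v \/ dichotomy u v.

Lemma eq_or_dichotomy_conjg u v g :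
  eq_or_dichotomy (u ^ g) (v ^ g) <-> eq_or_dichotomy u v.
Proof.
have main (u' v' h : G) : eq_or_dichotomy u' v' -> eq_or_dichotomy (u' ^ h) (v' ^ h).
  case=> [->|[[c uv]|p]]; [by left| |].
    right; left; split; last exact: indep_conjg.
    by rewrite /commute -!conjMg c.
  by right; right; apply: pingpong_conjg.
by split=> [/(main _ _ (g^-1))|]; [rewrite !conjgK|apply: main].
Qed.

End Conjugation.

(** * Reduced words and their initial powers *)
Section ReducedWords.
Context {L : choiceType}.
Implicit Types (l m : L * bool) (s w : seq (L * bool)).

Definition linv l := (l.1, ~~ l.2).

Lemma linvK : involutive linv.
Proof. by case=> a b; rewrite /linv /= negbK. Qed.

Definition noncancel l m := m != linv l.
Definition reduced s := sorted noncancel s.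

(** Left multiplication of a reduced word by a letter. *)
Definition step l s := if s is m :: s' then
  if m == linv l then s' else l :: s else [:: l].

Lemma reduced_behead l s : reduced (l :: s) -> reduced s.
Proof. by case: s => [|m s] //= /andP[]. Qed.

Lemma step_reduced l s : reduced s -> reduced (step l s).
Proof.
case: s => [|m s] //= rs; case: eqP => [_|/eqP ml]; last by apply/andP.
exact: reduced_behead rs.
Qed.

Lemma stepK l s : reduced s -> step l (step (linv l) s) = s.
Proof.
case: s => [|m s] /=; first by rewrite eqxx.
rewrite linvK; case: (eqVneq m l) => [->|_] rs; last by rewrite /= eqxx.
by case: s rs => [|m' s] //= /andP[/negPf -> _].
Qed.

Lemma foldr_step w s : reduced (w ++ s) -> foldr step s w = w ++ s.
Proof.
elim: w => [|l w IHw] //= rs; rewrite IHw; last exact: reduced_behead rs.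
case: (w ++ s) rs => //= m t /andP[/negPf e _].
by rewrite e.
Qed.

Lemma reduced_cat s l m t :
  reduced (rcons s l) -> noncancel l m -> reduced (m :: t) ->
  reduced (rcons s l ++ m :: t).
Proof.
case: s => [|l' s] /=; first by move=> _ -> ->.
by rewrite cat_path last_rcons /= => -> -> ->.
Qed.

Lemma linv_noncancel l m : noncancel (linv m) (linv l) = noncancel l m.
Proof. by rewrite /noncancel linvK eq_sym. Qed.

Lemma reduced_word_inv s : reduced (word_inv s) = reduced s.
Proof.
rewrite /reduced /word_inv rev_sorted sorted_map.
by apply: eq_sorted => l m /=; apply: linv_noncancel.
Qed.

Section Profile.
Local Open Scope ring_scope.
Context (z : L).

Definition sign_of (b : bool) : int := if b then -1 else 1.

(** What ping-pong looks at: the exponent of the initial power of z and the letter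
that follows it. *)
Fixpoint profile s : int * option (L * bool) :=
  if s is l :: s' then
    if l.1 == z then ((profile s').1 + sign_of l.2, (profile s').2) else (0, Some l)
  else (0, None).

Lemma sign_ofN b : sign_of (~~ b) = - sign_of b.
Proof. by case: b => //=; rewrite opprK. Qed.

Lemma profile_step_z b s :
  profile (step (z, b) s) = ((profile s).1 + sign_of b, (profile s).2).
Proof.
case: s => [|m s] /=; first by rewrite eqxx.
case: eqP => [->|_] /=; rewrite eqxx //= sign_ofN addrNK.
by case: (profile s).
Qed.

Lemma profile_step l s : l.1 != z -> profile s != (0, Some (linv l)) ->
  profile (step l s) = (0, Some l).
Proof.
case: s => [|m s] /= lz; first by rewrite (negPf lz).
case: (eqVneq m (linv l)) => [->|_] /=; last by rewrite (negPf lz).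
by rewrite (negPf lz) eqxx.
Qed.

Lemma profile_run b s : reduced ((z, b) :: s) ->
  0 < sign_of b * (profile ((z, b) :: s)).1.
Proof.
elim: s b => [|[a c] s IHs] b; first by rewrite /= eqxx add0r; case: b.
move=> rs; rewrite [profile _]/= eqxx; case: (eqVneq a z) => [az|_] /=; last first.
  by rewrite add0r; case: b {rs}.
move: rs; rewrite az => rs.
have bc : b = c.
  by move: rs => /= /andP[]; rewrite /noncancel /linv xpair_eqE eqxx /=; case: b c => -[].
rewrite -bc in rs *; have := IHs b (reduced_behead rs).
by rewrite /= eqxx /=; case: b {rs bc} => /=; lia.
Qed.

Lemma profile_head l s : reduced s -> profile s = (0, Some l) ->
  exists s', s = l :: s'.
Proof.
case: s => [|[a b] s] //= rs; case: eqP => [az|_]; last by case=> <-; exists s.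
move: rs; rewrite az => /profile_run; rewrite /= eqxx /= => h [e _].
by move: h; rewrite e mulr0.
Qed.

Lemma profile_cons_reduced l s : reduced (l :: s) -> profile s != (0, Some (linv l)).
Proof.
move=> rs; apply/eqP => /(profile_head (reduced_behead rs))[s' es].
by move: rs; rewrite es /= /noncancel eqxx.
Qed.

Lemma profile_neq0 s : (profile s).1 != 0 -> exists b s', s = (z, b) :: s'.
Proof.
case: s => [|[a b] s] //=.
by case: (eqVneq a z) => [->|_] // _; exists b, s.
Qed.

End Profile.
End ReducedWords.

(** * Free groups *)

Section FreeGroup.
Local Open Scope group_scope.
Context {L : choiceType}.

Definition no_rel (_ _ : seq (L * bool)) := False.
Definition free_group : Type := pres_group no_rel.
HB.instance Definition _ := Group.on free_group.

Definition lett (l : L * bool) : free_group := pres_class (grp_rel no_rel) [:: l].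

Lemma lettV l : lett (linv l) = (lett l)^-1.
Proof.
apply/esym/mulg1_eq; rewrite [lett l * _]pres_mul_class.
by apply/pres_classP/pres_congr_rel; case: l => a b; apply: grp_rel_cancel.
Qed.

Lemma lett_cons l w : pres_class (grp_rel no_rel) (l :: w) =
  lett l * (pres_class (grp_rel no_rel) w : free_group).
Proof. by rewrite [RHS]pres_mul_class. Qed.

Lemma free_ind (P : free_group -> Prop) :
  P 1 -> (forall l g, P g -> P (lett l * g)) -> forall g, P g.
Proof.
move=> P1 PS g; rewrite -(pres_class_repr g).
by elim: (repr g) => [//|l w IHw]; rewrite lett_cons; apply: PS.
Qed.

Lemma free_ext (H : groupType) (f1 f2 : free_group -> H) :
  {morph f1 : x y / x * y} -> {morph f2 : x y / x * y} ->
  (forall a, f1 (lett (a, false)) = f2 (lett (a, false))) -> f1 =1 f2.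
Proof.
have m1 (f : free_group -> H) : {morph f : x y / x * y} -> f 1 = 1.
  by move=> fM; apply: (mulgI (f 1)); rewrite -fM !mulg1.
have mV (f : free_group -> H) x : {morph f : x y / x * y} -> f x^-1 = (f x)^-1.
  by move=> fM; apply/esym/mulg1_eq; rewrite -fM mulgV m1.
move=> M1 M2 e; elim/free_ind => [|[a b] g IHg]; first by rewrite !m1.
rewrite M1 M2 IHg; congr (_ * _); case: b => //.
by rewrite -[true]/(~~ false) -/(linv (a, false)) lettV !mV // e.
Qed.

Section Lift.
Context {H : groupType} (f : L -> H).

Let fb (l : L * bool) := if l.2 then (f l.1)^-1 else f l.1.

Lemma fb_rel u v : grp_rel no_rel u v -> \prod_(l <- u) fb l = \prod_(l <- v) fb l.
Proof.
by case=> // a [] /=; rewrite !big_cons !big_nil /fb /= mulg1 ?mulgV ?mulVg.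
Qed.

Definition free_lift : free_group -> H := pres_lift fb.

Lemma free_liftM : {morph free_lift : x y / x * y}.
Proof. exact: pres_liftM fb_rel. Qed.

Lemma free_lift_lett l : free_lift (lett l) = if l.2 then (f l.1)^-1 else f l.1.
Proof. exact: pres_lift_gen fb_rel l. Qed.

Lemma free_lift1 : free_lift 1 = 1.
Proof. exact: pres_lift1 fb_rel. Qed.

Lemma free_liftV x : free_lift x^-1 = (free_lift x)^-1.
Proof. by apply/esym/mulg1_eq; rewrite -free_liftM mulgV free_lift1. Qed.

End Lift.
End FreeGroup.
Arguments free_group L : clear implicits.

Section WordAction.
Context {X : choiceType} {W : Type} (f : X -> W -> W) (I : W -> Prop).
Context (R : seq X -> seq X -> Prop).
Hypothesis f_stable : forall x w, I w -> I (f x w).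
Hypothesis f_rel : forall s t, R s t -> forall w, I w -> foldr f w s = foldr f w t.

Lemma foldr_stable s w : I w -> I (foldr f w s).
Proof. by move=> Iw; elim: s => //= x s IHs; apply: f_stable. Qed.

(** The invariant I is needed because cancellation of letters holds only on
reduced words. *)
Lemma foldr_congr s t : pres_congr R s t ->
  forall w, I w -> foldr f w s = foldr f w t.
Proof.
elim=> {s t} [s t /f_rel //|//|s t _ IH w Iw|r s t _ IH1 _ IH2 w Iw|
  s s' t t' _ IH1 _ IH2 w Iw].
- by rewrite IH.
- by rewrite IH1 // IH2.
- by rewrite !foldr_cat IH2 // IH1 //; apply: foldr_stable.
Qed.

End WordAction.

Section NormalForm.
Local Open Scope group_scope.
Context {L : choiceType}.
Implicit Types (l : L * bool) (w : seq (L * bool)) (g : free_group L).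

Definition nf g : seq (L * bool) := foldr step [::] (repr g).

Lemma nf_class w : nf (pres_class (grp_rel no_rel) w) = foldr step [::] w.
Proof.
apply: (@foldr_congr _ _ step reduced (grp_rel no_rel)) => //.
- by move=> l s; apply: step_reduced.
- by move=> _ _ [a b|//] s rs; apply: (stepK (a, b)).
- exact: pres_repr_class.
Qed.

Lemma nf1 : nf 1 = [::].
Proof. exact: (nf_class [::]). Qed.

Lemma nf_lett l g : nf (lett l * g) = step l (nf g).
Proof. by rewrite -{1}(pres_class_repr g) -lett_cons nf_class. Qed.

Lemma nf_reduced g : reduced (nf g).
Proof.
by move: g; apply: free_ind => [|l g]; rewrite ?nf1 // nf_lett; apply: step_reduced.
Qed.

Lemma nfK g : pres_class (grp_rel no_rel) (nf g) = g.
Proof.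
move: g; apply: free_ind => [|l g IHg]; first by rewrite nf1.
rewrite nf_lett -{2}IHg -lett_cons; case: (nf g) => [|m s] //=.
case: eqP => // ->.
by rewrite !lett_cons lettV mulVKg.
Qed.

(** Endomorphisms that conjugate the letters in Y by z or by its inverse and fix
the other letters, z included. *)
Section Twist.
Context (z : L) (d : bool) (Y : pred L) (phi : free_group L -> free_group L).
Hypothesis phiM : {morph phi : x y / x * y}.
Hypothesis zY : ~~ Y z.
Hypothesis phiY : forall l, Y l.1 ->
  phi (lett l) = lett (z, d) * lett l * (lett (z, d))^-1.
Hypothesis phiNY : forall l, ~~ Y l.1 -> phi (lett l) = lett l.

Definition shift_profile (p : int * option (L * bool)) : int * option (L * bool) :=
  ((p.1 + if p.2 is Some l then if Y l.1 then sign_of d else 0 else 0)%R, p.2).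

(** By induction on the reduced word of g.  In the image of l :: s with l in Y, the
letter l could cancel only if the inverse of the conjugating letter and the image
of s together began with the inverse of l.  That letter is also in Y, so the two
conjugating letters in front of it compensate each other, and s itself would
begin with the inverse of l. *)
Lemma profile_twist g : profile z (nf (phi g)) = shift_profile (profile z (nf g)).
Proof.
have phi1 : phi 1 = 1 by apply: (mulgI (phi 1)); rewrite -phiM !mulg1.
have phiNfM l w : phi (pres_class (grp_rel no_rel) (l :: w)) =
  phi (lett l) * phi (pres_class (grp_rel no_rel) w) by rewrite lett_cons phiM.
rewrite -{1}(nfK g); have := nf_reduced g; elim: (nf g) => [_|l s IHs rs].
  by rewrite phi1 nf1 /shift_profile /= addr0.
have {}IHs := IHs (reduced_behead rs); rewrite phiNfM /=.
have pl := profile_cons_reduced z rs.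
case: (eqVneq l.1 z) => [lz|lz].
  have -> : l = (z, l.2) by rewrite -lz; case: (l).
  rewrite phiNY //= nf_lett profile_step_z IHs /shift_profile /=; congr (_, _).
  by rewrite addrAC.
case: (boolP (Y l.1)) => lY; last first.
  rewrite phiNY // nf_lett profile_step //; first by rewrite /shift_profile /= (negPf lY) addr0.
  rewrite IHs; apply: contra pl => /eqP; case: (profile z s) => p [m|] //.
  by rewrite /shift_profile /= => -[e em]; move: e; rewrite em /= (negPf lY) addr0 => ->.
rewrite phiY // -mulgA -mulgA -lettV !nf_lett profile_step_z profile_step //=.
  by rewrite /shift_profile /= lY.
rewrite profile_step_z IHs; apply: contra pl.
case: (profile z s) => p [m|] /eqP // [e em]; move: e; rewrite em /= lY sign_ofN.
by rewrite addrK => ->.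
Qed.

End Twist.
End NormalForm.

(** * Ping-pong between a conjugate of a letter and a shift *)
Section PingPongEngine.
Local Open Scope group_scope.
Context {G : groupType} {L : choiceType} (E : L -> G) (D : pred L).
Implicit Types (l : L * bool) (w : seq (L * bool)).

Definition ev_letter l : G := if l.2 then (E l.1)^-1 else E l.1.
Definition ev w : G := \prod_(l <- w) ev_letter l.
Definition letters_in w := all (fun l => D l.1) w.

Lemma ev0 : ev [::] = 1.
Proof. exact: big_nil. Qed.

Lemma ev_cons l w : ev (l :: w) = ev_letter l * ev w.
Proof. exact: big_cons. Qed.

Lemma ev_cat w1 w2 : ev (w1 ++ w2) = ev w1 * ev w2.
Proof. exact: big_cat. Qed.

Lemma ev_rcons w l : ev (rcons w l) = ev w * ev_letter l.
Proof. by rewrite -cats1 ev_cat ev_cons ev0 mulg1. Qed.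

Lemma ev_letter_linv l : ev_letter (linv l) = (ev_letter l)^-1.
Proof. by case: l => a []; rewrite /ev_letter /= ?invgK. Qed.

Lemma ev_nseq l k : ev (nseq k l) = ev_letter l ^+ k.
Proof. by elim: k => [|k IHk] /=; [exact: ev0|rewrite ev_cons IHk expgS]. Qed.

Lemma word_inv_cons l w : word_inv (l :: w) = rcons (word_inv w) (linv l).
Proof. by rewrite /word_inv /= rev_cons. Qed.

Lemma word_inv_rcons l w : word_inv (rcons w l) = linv l :: word_inv w.
Proof. by rewrite /word_inv map_rcons rev_rcons. Qed.

Lemma ev_word_inv w : ev (word_inv w) = (ev w)^-1.
Proof.
elim: w => [|l w IHw]; first by rewrite /= !ev0 invg1.
by rewrite word_inv_cons ev_rcons IHw ev_cons invgM ev_letter_linv.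
Qed.

Lemma letters_in_inv w : letters_in (word_inv w) = letters_in w.
Proof. by rewrite /letters_in /word_inv all_rev all_map; apply: eq_all => -[]. Qed.

(** The group acts on W, and r attaches a reduced word to every point of the
part fib of W.  On words, the elements E a with a in D act as letters, and v
changes by 1 the exponent of the initial power of z if it is followed by a letter
in Y. *)
Context (z : L) (Y : pred L) (d : bool) (v : G).
Context {W : Type} (act : G -> W -> W) (fib : W -> Prop) (r : W -> seq (L * bool)).

Hypothesis act1 : forall o, act 1 o = o.
Hypothesis actM : forall g h o, act (g * h) o = act g (act h o).
Hypothesis r_reduced : forall o, fib o -> reduced (r o).
Hypothesis actE : forall l o, D l.1 -> fib o ->
  fib (act (ev_letter l) o) /\ r (act (ev_letter l) o) = step l (r o).
Hypothesis actv : forall b o, fib o ->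
  fib (act (if b then v^-1 else v) o) /\
  forall l, Y l.1 -> (profile z (r o)).2 = Some l ->
  profile z (r (act (if b then v^-1 else v) o)) =
    ((profile z (r o)).1 + sign_of (d (+) b), Some l)%R.
Hypothesis zY : ~~ Y z.
Hypothesis centY : forall a, D a -> ~~ Y a -> commute (E a) v.
Hypothesis Ybase : exists o y, [/\ fib o, Y y & r o = [:: (y, false)]].

Lemma act_ev w o : letters_in w -> fib o ->
  fib (act (ev w) o) /\ r (act (ev w) o) = foldr step (r o) w.
Proof.
elim: w => [_ fo|l w IHw /andP[Dl Dw] fo] /=; first by rewrite ev0 act1.
have [f1 <-] := IHw Dw fo.
by rewrite ev_cons actM; apply: actE.
Qed.

Lemma act_powers_v k b o l : fib o -> Y l.1 -> (profile z (r o)).2 = Some l ->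
  let o' := act ((if b then v^-1 else v) ^+ k) o in
  fib o' /\ profile z (r o') = ((profile z (r o)).1 + sign_of (d (+) b) *+ k, Some l)%R.
Proof.
move=> fo Yl pl; elim: k => [|k [f1 IHk]] /=.
  by rewrite expg0 act1 addr0 -pl; split=> //; case: (profile z (r o)).
rewrite expgS actM; have [f2 p2] := actv b f1; split=> //.
by rewrite (p2 l) ?IHk //= -addrA mulrSr.
Qed.

Lemma nseq_rcons (T : Type) k (x : T) : rcons (nseq k x) x = nseq k.+1 x.
Proof. by elim: k => //= k ->. Qed.

Lemma reduced_nseq k l : reduced (nseq k l).
Proof.
case: k => // k; elim: k => //= k ->; rewrite andbT.
by case: l => a b; rewrite /noncancel /linv xpair_eqE /= negb_and; case: b; rewrite orbT.
Qed.

(** This is the word of a nontrivial power of the conjugate of E x by ev w. *)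
Lemma conj_word_reduced w x b k :
  reduced w -> (if w is m :: _ then m.1 != x else true) ->
  reduced (word_inv w ++ nseq k.+1 (x, b) ++ w).
Proof.
case: w => [|m w] rw mx; first by rewrite cats0; apply: reduced_nseq.
rewrite word_inv_cons; apply: reduced_cat.
- by rewrite -word_inv_cons reduced_word_inv.
- by rewrite /noncancel linvK; apply: contra mx => /eqP <-.
change (reduced (nseq k.+1 (x, b) ++ m :: w)).
rewrite -nseq_rcons; apply: reduced_cat => //.
  by rewrite nseq_rcons; apply: reduced_nseq.
by rewrite /noncancel; apply: contra mx => /eqP ->.
Qed.

(** The words of the nontrivial powers of the conjugate of E x begin and end with
letters in Y, so they can be put in front of a word that begins with z without
any cancellation. *)
Lemma pingpong_conj w x :
  letters_in w -> D x -> reduced w ->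
  (if w is m :: _ then m.1 != x else true) ->
  Y (last (x, false) w).1 ->
  pingpong (E x ^ ev w) v.
Proof.
move=> Dw Dx rw mx Yw.
pose Xu o := fib o /\ exists l, Y l.1 /\ profile z (r o) = (0%R, Some l).
pose Xv o := fib o /\ exists p l, [/\ p != 0%R, Y l.1 & profile z (r o) = (p, Some l)].
have stepv x' o : powers v x' -> x' <> 1 -> Xu o -> Xv (act x' o).
  move=> vx' x1 [fo [l [Yl pl]]].
  have [k [b ex]] : exists k b, x' = (if b then v^-1 else v) ^+ k.
    by case: vx' => k [->|->]; exists k; [exists false|exists true; rewrite expVgn].
  have [|f1 p1] := act_powers_v k b fo Yl; first by rewrite pl.
  rewrite ex; split=> //; exists (sign_of (d (+) b) *+ k)%R, l; split=> //; last first.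
    by rewrite p1 pl add0r.
  case: k ex {f1 p1} => [|k] ex; first by rewrite ex expg0 in x1.
  by rewrite mulrn_eq0 /=; case: (d (+) b).
exists W, act, Xu, Xv; split=> //.
- have [o [y [fo Yy ro]]] := Ybase.
  have po : profile z (r o) = (0%R, Some (y, false)).
    by rewrite ro /=; case: eqP => // yz; move: zY; rewrite -yz Yy.
  have [|f1 p1] := @act_powers_v 1 false o (y, false) fo Yy; first by rewrite po.
  exists (act (v ^+ 1) o); split=> //; exists (sign_of (d (+) false)), (y, false).
  by split=> //; [case: (d)|rewrite p1 po add0r].
- by move=> o [_ [l [_ pl]]] [_ [p [m [p0 _]]]]; rewrite pl => -[e _]; rewrite -e eqxx in p0.
- move=> x' o ux x1 [fo [p [l [p0 _ pl]]]].
  have [k [b ex]] : exists k b, x' = ev (word_inv w ++ nseq k.+1 (x, b) ++ w).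
    have exb k b : ev_letter (x, b) ^+ k ^ ev w = ev (word_inv w ++ nseq k (x, b) ++ w).
      by rewrite !ev_cat ev_word_inv ev_nseq conjgE.
    case: ux => -[|k] [xe|xe].
    + by case: x1.
    + by case: x1; rewrite xe invg1.
    + by exists k, false; rewrite -exb xe conjXg.
    + by exists k, true; rewrite -exb xe -expVgn -conjVg conjXg.
  have DW : letters_in (word_inv w ++ nseq k.+1 (x, b) ++ w).
    rewrite /letters_in !all_cat -!/(letters_in _) letters_in_inv Dw /=.
    by rewrite /letters_in all_nseq /= Dx orbT.
  have [f1 r1] := act_ev DW fo; rewrite ex; split=> //.
  have rW := conj_word_reduced b k rw mx.
  have [W1 [m [eW Ym]]] : exists W1 m, word_inv w ++ nseq k.+1 (x, b) ++ w = rcons W1 m /\ Y m.1.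
    case/lastP: w Yw {ux Dw rw mx ex DW f1 r1 rW} => [|w m] Yw.
      by exists (nseq k (x, b)), (x, b); rewrite nseq_rcons cats0.
    exists (word_inv (rcons w m) ++ nseq k.+1 (x, b) ++ w), m.
    by rewrite -!rcons_cat; move: Yw; rewrite last_rcons.
  have [m' [W2 [eW2 Ym']]] : exists m W2, word_inv w ++ nseq k.+1 (x, b) ++ w = m :: W2 /\ Y m.1.
    case/lastP: w Yw {ux Dw rw mx ex DW f1 r1 rW eW} => [|w m'] Yw.
      by exists (x, b), (nseq k (x, b)); rewrite cats0.
    rewrite word_inv_rcons; eexists; eexists; split; first by [].
    by move: Yw; rewrite last_rcons.
  have [b' [s' es]] : exists b s', r o = (z, b) :: s' by apply: profile_neq0; rewrite pl.
  have nz a : Y a -> a != z by apply: contraTneq => ->.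
  have rWs : reduced (rcons W1 m ++ r o).
    rewrite es; apply: reduced_cat; first by rewrite -eW.
      rewrite /noncancel; apply: contraTneq (nz _ Ym) => e.
      by rewrite negbK; apply/eqP; have := congr1 fst e.
    by rewrite -es; apply: r_reduced.
  exists m'; split=> //.
  by rewrite r1 eW foldr_step // -eW eW2 /= (negPf (nz _ Ym')).
Qed.

Lemma reducedPn w : ~~ reduced w -> exists w1 l w2, w = w1 ++ l :: linv l :: w2.
Proof.
elim: w => [|l w IHw] //; case: w IHw => [|m w] // IHw.
rewrite [reduced _]/= negb_and negbK => /orP[/eqP ->|nr].
  by exists [::], l, w.
have [w1 [l' [w2 e]]] := IHw nr.
by exists (l :: w1), l', w2; rewrite e.
Qed.

(** A conjugating word w of minimal length is reduced, does not begin with x, and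
does not end with a letter outside Y, because the pair can be conjugated by such
a letter, which commutes with v.  What remains is ping-pong, or an empty w and a
letter x outside Y. *)
Lemma conj_dichotomy (Dx : pred L) :
  (forall x, Dx x -> D x) ->
  (forall x, Dx x -> ~~ Y x -> eq_or_dichotomy (E x) v) ->
  forall w x, letters_in w -> Dx x -> eq_or_dichotomy (E x ^ ev w) v.
Proof.
move=> DxD leaf w; have [k] := ubnP (size w); elim: k w => // k IHk w wk x Dw Dxx.
have Dx1 := DxD _ Dxx.
case: (boolP (reduced w)) => [rw|/reducedPn[w1 [l [w2 ew]]]]; last first.
  move: wk Dw; rewrite ew /letters_in size_cat all_cat /= => wk /and4P[D1 _ _ D2].
  have -> : ev (w1 ++ l :: linv l :: w2) = ev (w1 ++ w2).
    by rewrite !ev_cat !ev_cons ev_letter_linv mulVKg.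
  apply: IHk => //; last by rewrite /letters_in all_cat D1.
  by rewrite size_cat; lia.
case: (boolP (if w is m :: _ then m.1 != x else true)) => mx; last first.
  case: w wk Dw rw mx => // -[a b] w wk /andP[_ Dw] _ /= /negPn/eqP ax.
  have {}wk : size w < k := wk.
  rewrite ev_cons conjgM; have -> : E x ^ ev_letter (a, b) = E x.
    rewrite ax /ev_letter; case: b => /=; apply/conjg_fixP/commgP => //.
    by apply/commute_sym/commute_sym/commuteV.
  exact: IHk.
case: (boolP (Y (last (x, false) w).1)) => Yw.
  by right; right; apply: pingpong_conj.
case/lastP: w wk Dw rw mx Yw => [_ _ _ _ Yw|w m wk].
  by rewrite ev0 conjg1; apply: leaf.
rewrite /letters_in all_rcons size_rcons last_rcons in wk * => /andP[Dm Dw] _ _ Ym.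
rewrite ev_rcons conjgM.
have -> : v = v ^ ev_letter m.
  apply/esym/conjg_fixP/commgP; rewrite /ev_letter; case: m.2; last first.
    by apply/commute_sym/centY.
  by apply/commuteV/commute_sym/centY.
by apply/eq_or_dichotomy_conjg/IHk.
Qed.

End PingPongEngine.

(** * Generators and pushes of the first string *)
Section BraidGenerators.
Local Open Scope group_scope.
Context (n : nat).
Local Notation m := n.-1.

(** Indexing by nat avoids casts between ordinals; the value 1 out of range keeps
the commutation of distant generators unconditional. *)
Definition sig (k : nat) : braid n := if insub k is Some i then sigma i else 1.

Local Notation s := sig.

Lemma sig_sigma (i : 'I_m) : s i = sigma i.
Proof. by rewrite /sig valK. Qed.

Lemma sig_far j k : j.+1 < k -> commute (s j) (s k).
Proof.
move=> jk; rewrite /sig; case: insubP => [i _ ei|_]; last exact/commute_sym/commute1.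
case: insubP => [l _ el|_]; last exact: commute1.
rewrite /commute [LHS]pres_mul_class [RHS]pres_mul_class.
by apply/pres_classP/pres_congr_rel/grp_rel_of/braid_far; rewrite ei el; lia.
Qed.

Lemma sig_near k : k.+1 < m -> s k * s k.+1 * s k = s k.+1 * s k * s k.+1.
Proof.
move=> km; pose i := Ordinal (ltnW km); pose j := Ordinal km.
rewrite -[k]/(val i) -[(val i).+1]/(val j) !sig_sigma.
rewrite [sigma i * _]pres_mul_class [sigma j * _]pres_mul_class.
rewrite [LHS]pres_mul_class [RHS]pres_mul_class.
apply/pres_classP/pres_congr_rel/grp_rel_of/braid_near => /=; lia.
Qed.

Lemma sig_conj k : k.+1 < m -> s k.+1 = s k ^ (s k * s k.+1)^-1.
Proof.
by move=> /sig_near e; rewrite conjgE invgK !invgM !mulgA e !mulgK.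
Qed.

Lemma sig_conj0 k : k < m -> exists g, s k = s 0 ^ g.
Proof.
elim: k => [_|k IHk km]; first by exists 1; rewrite conjg1.
have [g e] := IHk (ltnW km); exists (g * (s k * s k.+1)^-1).
by rewrite conjgM -e; apply: sig_conj.
Qed.

(** The product of the first k generators, which moves string 0 to position k. *)
Fixpoint carry k : braid n := if k is k'.+1 then carry k' * s k' else 1.

Local Notation T := carry.

Lemma sig_carry_far i k : k < i -> commute (s i) (T k).
Proof.
elim: k => [_|k IHk ki]; first exact: commute1.
by apply: commuteM; [apply/IHk/ltnW|apply/commute_sym/sig_far].
Qed.

Lemma sig_carry_shift i k : i.+1 < k -> k <= m -> s i.+1 * T k = T k * s i.
Proof.
elim: k => // k IHk; rewrite ltnS leq_eqVlt => /orP[/eqP <-|ik] km /=.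
  by rewrite !mulgA (sig_carry_far (ltnSn i)) -3!mulgA (mulgA (s i.+1)) -sig_near ?mulgA.
by rewrite mulgA IHk ?(ltnW km) // -!mulgA (sig_far ik).
Qed.

(** The pure braid in which string 0 goes to string k.+1, makes a full twist with
it and comes back. *)
Definition push k : braid n := s k ^+ 2 ^ (T k)^-1.

Local Notation X := push.

Lemma push_commute i k : k < m -> (k < i) || (i.+1 < k) -> commute (X k) (s i.+1).
Proof.
move=> km /orP[ki|ik]; apply/commgP/conjg_fixP; rewrite /push -conjgM.
  rewrite -(commuteV (sig_carry_far (leqW ki))) conjgM; congr (_ ^ _).
  by apply/conjg_fixP/commgP/commute_sym/commuteX/commute_sym/sig_far.
have -> : (T k)^-1 * s i.+1 = s i * (T k)^-1.
  by apply: (mulIg (T k)); rewrite mulgVK -mulgA sig_carry_shift ?mulKg // ltnW.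
rewrite conjgM; congr (_ ^ _).
by apply/conjg_fixP/commgP/commute_sym/commuteX/sig_far.
Qed.

Lemma push_succ k : k.+1 < m -> X k ^ s k.+1 = X k.+1.
Proof.
move=> km; rewrite /push /= -conjgM invgM -(commuteV (sig_carry_far (ltnSn k))) !conjgM.
congr (_ ^ _); have e := sig_near km.
have e3 : s k * (s k * s k.+1 * s k) = s k.+1 * s k * s k.+1 * s k.+1.
  by rewrite e !mulgA e.
rewrite !conjgE invgK !expg2; apply: (mulIg (s k)); rewrite !mulgA mulgVK.
by apply: (mulgI (s k.+1)); rewrite -!mulgA mulVKg !mulgA -e3 !mulgA.
Qed.

(** This product is a full turn of string 0 around strings k.+1 and k.+2
together, which the crossing of these two strings does not see. *)
Lemma push_prod_commute k : k.+1 < m -> commute (X k.+1 * X k) (s k.+1).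
Proof.
move=> km; have e := sig_near km.
have -> : X k.+1 * X k = (s k * s k.+1 ^+ 2 * s k) ^ (T k)^-1.
  rewrite /push /= invgM conjgM -conjMg; congr (_ ^ _).
  by rewrite conjgE invgK !expg2 !mulgA mulgVK.
apply/commgP/conjg_fixP; rewrite -conjgM -(commuteV (sig_carry_far (ltnSn k))) conjgM.
congr (_ ^ _); apply/conjg_fixP/commgP; rewrite /commute expg2 !mulgA.
rewrite -[LHS]mulgA -[LHS]mulgA [s k.+1 * (s k * _)]mulgA -e.
by rewrite !mulgA e.
Qed.

Lemma push_succ_conj k : k.+1 < m -> X k.+1 ^ s k.+1 = X k ^ (X k.+1)^-1.
Proof.
move=> km; have := push_prod_commute km => /commgP/conjg_fixP.
rewrite conjMg push_succ // => e; rewrite [RHS]conjgE invgK mulgA -e.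
by rewrite mulgK.
Qed.

Lemma push_succV k : k.+1 < m -> X k.+1 ^ (s k.+1)^-1 = X k.
Proof. by move=> km; rewrite -push_succ // conjgK. Qed.

Lemma push_conjV k : k.+1 < m -> X k ^ (s k.+1)^-1 = X k.+1 ^ X k.
Proof.
move=> km; have := commuteV (push_prod_commute km) => /commgP/conjg_fixP.
rewrite conjMg push_succV // => e; rewrite [RHS]conjgE -e.
by rewrite mulKg.
Qed.

End BraidGenerators.

(** * Combing the first string *)
Section WordValues.
Local Open Scope group_scope.
Context {G : groupType} {L : choiceType} (E : L -> G) (D : pred L).

Definition word_value g := exists2 w, letters_in D w & g = ev E w.

Lemma word_valueM g h : word_value g -> word_value h -> word_value (g * h).
Proof.
move=> [w Dw ->] [w' Dw' ->]; exists (w ++ w'); last by rewrite ev_cat.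
by rewrite /letters_in all_cat; apply/andP.
Qed.

Lemma word_valueV g : word_value g -> word_value g^-1.
Proof.
by move=> [w Dw ->]; exists (word_inv w); rewrite ?letters_in_inv ?ev_word_inv.
Qed.

Lemma word_value1 : word_value 1.
Proof. by exists [::]; rewrite ?ev0. Qed.

Lemma word_value_letter a : D a -> word_value (E a).
Proof.
by move=> Da; exists [:: (a, false)]; rewrite ?ev_cons ?ev0 ?mulg1 // /letters_in /= Da.
Qed.

Lemma word_valueJ g h : word_value g -> word_value h -> word_value (g ^ h).
Proof.
by move=> Wg Wh; rewrite conjgE; apply/word_valueM/word_valueM; first exact: word_valueV.
Qed.

Lemma word_value_map (E' : L -> G) (D' : pred L) (phi : G -> G) g :
  {morph phi : x y / x * y} ->
  (forall a, D' a -> word_value (phi (E' a))) ->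
  (exists2 w, letters_in D' w & g = ev E' w) -> word_value (phi g).
Proof.
move=> phiM W [w Dw ->].
have phi1 : phi 1 = 1 by apply: (mulgI (phi 1)); rewrite -phiM !mulg1.
elim: w Dw => [_|[a b] w IHw /andP[/= Da Dw]].
  by rewrite ev0 phi1; apply: word_value1.
rewrite ev_cons phiM; apply: word_valueM; last exact: IHw.
rewrite /ev_letter /=; case: b; last exact: W.
have -> : phi (E' a)^-1 = (phi (E' a))^-1.
  by apply/esym/mulg1_eq; rewrite -phiM mulgV phi1.
exact/word_valueV/W.
Qed.

End WordValues.

Section Combing.
Local Open Scope group_scope.
Context (n : nat).
Local Notation m := n.-1.
Local Notation s := (sig n).
Local Notation T := (carry n).
Local Notation X := (push n).
Local Notation D := (fun k : nat => k < m).
Local Notation pushing := (word_value X D).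

Definition inv_if (b : bool) (g : braid n) := if b then g^-1 else g.

Definition pushing_conj (u : braid n) :=
  exists x g, [/\ x < m, pushing g & u = X x ^ g].

Lemma pushing_conjJ u g : pushing_conj u -> pushing g -> pushing_conj (u ^ g).
Proof.
move=> [x [h [xm ph ->]]] pg; exists x, (h * g); split=> //; last by rewrite conjgM.
exact: word_valueM.
Qed.

(** A generator that does not move string 0 exchanges two consecutive pushes, up
to a correction that keeps their product, and commutes with the other ones. *)
Lemma push_conj_sig k j b : k < m -> j.+1 < m -> pushing_conj (X k ^ inv_if b (s j.+1)).
Proof.
move=> km jm.
have pX i g : i < m -> pushing g -> pushing_conj (X i ^ g) by exists i, g.
have p1 : pushing 1 by apply: word_value1.
have pj i : i < m -> pushing (X i) by move=> im; apply: word_value_letter.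
have jm' := ltnW jm.
have [ek|nk] := eqVneq k j; first rewrite ek.
  case: b => /=; first by rewrite push_conjV //; apply: pX; last exact: pj.
  by rewrite push_succ // -[X _]conjg1; apply: pX.
have [ek1|nk1] := eqVneq k j.+1; first rewrite ek1.
  case: b => /=; first by rewrite push_succV // -[X _]conjg1; apply: pX.
  by rewrite push_succ_conj //; apply: pX => //; apply/word_valueV/pj.
have c : commute (X k) (s j.+1) by apply: push_commute => //; lia.
have -> : X k ^ inv_if b (s j.+1) = X k.
  apply/conjg_fixP/commgP; case: b => //=; exact: commuteV.
by rewrite -[X k]conjg1; apply: pX.
Qed.

Lemma pushing_conj_word u : pushing_conj u -> pushing u.
Proof.
by move=> [x [g [xm pg ->]]]; apply: word_valueJ => //; apply: word_value_letter.
Qed.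

Lemma pushingJ_sig g j b : j.+1 < m -> pushing g -> pushing (g ^ inv_if b (s j.+1)).
Proof.
move=> jm; apply: (word_value_map (phi := conjg^~ (inv_if b (s j.+1)))) => [y z|a am].
  exact: conjMg.
exact/pushing_conj_word/push_conj_sig.
Qed.

Lemma pushing_conj_sig u j b : j.+1 < m -> pushing_conj u ->
  pushing_conj (u ^ inv_if b (s j.+1)).
Proof.
move=> jm [x [g [xm pg ->]]]; rewrite -conjgM conjgC conjgM.
by apply: pushing_conjJ; [exact: push_conj_sig|exact: pushingJ_sig].
Qed.

(** The braids that fix string 0, generated by right multiplications only: this
suffices for combing, and makes induction easy. *)
Inductive fix0 : braid n -> Prop :=
| fix0_1 : fix0 1
| fix0_sig h j b of j.+1 < m & fix0 h : fix0 (h * inv_if b (s j.+1))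
| fix0_push h k b of k < m & fix0 h : fix0 (h * inv_if b (X k)).

Lemma fix0_conj h u : fix0 h -> pushing_conj u -> pushing_conj (u ^ h).
Proof.
move=> fh pu; elim: fh => [|g j b jm _ IH|g k b km _ IH]; first by rewrite conjg1.
  by rewrite conjgM; apply: pushing_conj_sig.
rewrite conjgM; apply: pushing_conjJ => //.
have pk : pushing (X k) by apply: word_value_letter.
by case: b => //=; apply: word_valueV.
Qed.

Lemma carry_sig k i b : k <= m -> i < m ->
  exists h k', [/\ k' <= m, T k * inv_if b (s i) = h * T k' &
    forall g, fix0 g -> fix0 (g * h)].
Proof.
move=> km im; have [ik|ik|ik] := ltngtP i.+1 k.
- exists (inv_if b (s i.+1)), k; split=> // [|g fg]; last by apply: fix0_sig => //; lia.
  have e := sig_carry_shift ik km; case: b => //=.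
  apply: (mulgI (s i.+1)); rewrite mulgA e mulgK mulVKg //.
- have [ek|ki] := eqVneq i k; last first.
    case: i im ik ki => [|i] im ik ki; first by lia.
    exists (inv_if b (s i.+1)), k; split=> // [|g fg]; last by apply: fix0_sig => //; lia.
    have c : commute (s i.+1) (T k) by apply: sig_carry_far; lia.
    by case: b => /=; rewrite ?c //; apply/commuteV/commute_sym.
  rewrite ek in im *; case: b => /=.
    exists (inv_if true (X k)), k.+1; split=> // [|g fg]; last exact: fix0_push.
    rewrite /= /push -conjVg conjgE invgK -expVgn expg2.
    by rewrite !mulgA !mulgVK.
  exists 1, k.+1; split=> // [|g fg]; by rewrite ?mul1g ?mulg1.
- subst k => /=; case: b => /=.
    exists 1, i; split=> // [||g fg]; rewrite ?mulg1 ?mul1g ?mulgK //; exact: ltnW.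
  exists (inv_if false (X i)), i; split=> // [||g fg]; [exact: ltnW| |exact: fix0_push].
  by rewrite /= /push conjgE invgK expg2 !mulgA mulgVK.
Qed.

(** The products of a braid that fixes string 0 and one of the braids carry k
are stable under right multiplication by a generator or its inverse. *)
Lemma comb g : exists h k, [/\ k <= m, fix0 h & g = h * T k].
Proof.
rewrite -(pres_class_repr g); elim/last_ind: (repr g) => [|w [i b] [h [k [km fh e]]]].
  by exists 1, 0; split; rewrite ?mulg1 //; apply: fix0_1.
have -> : pres_class (grp_rel (braid_rel (n:=n))) (rcons w (i, b)) =
    pres_class _ w * inv_if b (s i).
  rewrite -cats1 -pres_mul_class; congr (_ * _); rewrite sig_sigma; case: b => //=.
  apply: (mulgI (sigma i : braid n)); rewrite mulgV [LHS]pres_mul_class.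
  exact/pres_classP/pres_congr_rel/(grp_rel_cancel _ _ false).
have [h' [k' [km' e' fh']]] := @carry_sig k i b km (ltn_ord i).
exists (h * h'), k'; split=> //; first exact: fh'.
by rewrite e -mulgA e' mulgA.
Qed.

(** A full twist of two neighbouring strings, seen from the initial position of
string 0, involves string 0 or not. *)
Lemma carry_conj_sqr k i : k <= m -> i < m ->
  (exists2 j, j < m & s i ^+ 2 ^ (T k)^-1 = X j) \/
  (exists2 j, j.+1 < m & s i ^+ 2 ^ (T k)^-1 = s j.+1 ^+ 2).
Proof.
move=> km im; have [ik|ik|ik] := ltngtP i.+1 k.
- right; exists i; first by lia.
  by rewrite conjXg conjgE invgK mulgA -(sig_carry_shift ik km) mulgK.
- have [->|ki] := eqVneq i k; first by left; exists k => //; lia.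
  case: i im ik ki => [|i] im ik ki; first by lia.
  right; exists i => //; apply/conjg_fixP/commgP/commuteV/commute_sym/commuteX.
  by apply/commute_sym/sig_carry_far; lia.
- left; exists i => //; subst k; rewrite /= invgM conjgM; congr (_ ^ _).
  by apply/conjg_fixP/commgP/commuteV/commute_sym/commuteX.
Qed.

End Combing.

(** * The Artin action *)
Section ArtinAction.
Local Open Scope group_scope.
Local Notation F := (free_group nat).

Definition gen (k : nat) : F := lett (k, false).

Lemma lett_gen l : lett l = if l.2 then (gen l.1)^-1 else gen l.1.
Proof. by case: l => k []; rewrite /= ?/gen -?lettV. Qed.

Definition artin k : F -> F := free_lift (fun l =>
  if l == k then gen k.+1 ^ gen k else if l == k.+1 then gen k else gen l).

Definition artinV k : F -> F := free_lift (fun l =>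
  if l == k then gen k.+1 else if l == k.+1 then gen k ^ (gen k.+1)^-1 else gen l).

Lemma artinM k : {morph artin k : g h / g * h}. Proof. exact: free_liftM. Qed.
Lemma artinVM k : {morph artinV k : g h / g * h}. Proof. exact: free_liftM. Qed.

Lemma artin_gen k l : artin k (gen l) =
  if l == k then gen k.+1 ^ gen k else if l == k.+1 then gen k else gen l.
Proof. by rewrite /artin free_lift_lett. Qed.

Lemma artinV_gen k l : artinV k (gen l) =
  if l == k then gen k.+1 else if l == k.+1 then gen k ^ (gen k.+1)^-1 else gen l.
Proof. by rewrite /artinV free_lift_lett. Qed.

Lemma artin_conj k g h : artin k (g ^ h) = artin k g ^ artin k h.
Proof. by rewrite !conjgE !artinM /artin free_liftV. Qed.

Lemma artin_inv k g : artin k g^-1 = (artin k g)^-1.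
Proof. exact: free_liftV. Qed.

Lemma artinV_inv k g : artinV k g^-1 = (artinV k g)^-1.
Proof. exact: free_liftV. Qed.

Lemma artinV_conj k g h : artinV k (g ^ h) = artinV k g ^ artinV k h.
Proof. by rewrite !conjgE !artinVM artinV_inv. Qed.

Lemma eqSn k : (k.+1 == k) = false. Proof. lia. Qed.
Lemma eqnS k : (k == k.+1) = false. Proof. lia. Qed.
Lemma eqSSn k : (k.+2 == k) = false. Proof. lia. Qed.
Lemma eqnSS k : (k == k.+2) = false. Proof. lia. Qed.

Definition eqs := (eqxx, eqSn, eqnS, eqSSn, eqnSS).

Definition artin_simp := (artin_conj, artinV_conj, artin_inv, artinV_inv,
  artinM, artinVM, artin_gen, artinV_gen).

Lemma artinK k : cancel (artinV k) (artin k).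
Proof.
apply: (free_ext (f2 := id)) => [g h|g h|l]; rewrite ?artinVM ?artinM //.
rewrite -/(gen l) artinV_gen; case: eqP => [->|lk]; first by rewrite artin_gen !eqs.
case: eqP => [->|lk']; first by rewrite !artin_simp !eqs conjgK.
by rewrite artin_gen; case: eqP => // _; case: eqP.
Qed.

Lemma artinVK k : cancel (artin k) (artinV k).
Proof.
apply: (free_ext (f2 := id)) => [g h|g h|l]; rewrite ?artinM ?artinVM //.
rewrite -/(gen l) artin_gen; case: eqP => [->|lk]; first by rewrite !artin_simp !eqs conjgKV.
case: eqP => [->|lk']; first by rewrite !artin_simp !eqs.
by rewrite artinV_gen; case: eqP => // _; case: eqP.
Qed.

Lemma far_eqs j k : j.+1 < k ->
  (((j == k) = false) * ((k == j) = false) * ((j.+1 == k) = false) *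
   ((k == j.+1) = false) * ((k.+1 == j) = false) * ((j == k.+1) = false) *
   ((k.+1 == j.+1) = false) * ((j.+1 == k.+1) = false))%type.
Proof. by move=> jk; do !split; lia. Qed.

Lemma artin_far j k : j.+1 < k -> artin j \o artin k =1 artin k \o artin j.
Proof.
move=> jk; have es := far_eqs jk.
apply: free_ext => [g h|g h|l] /=; rewrite ?artinM //.
rewrite -/(gen l) !artin_gen.
have [?|lj] := eqVneq l j; first by subst; rewrite !es; rewrite !(artin_simp, es, eqs).
have [?|lj'] := eqVneq l j.+1; first by subst; rewrite !es; rewrite !(artin_simp, es, eqs).
have [?|lk] := eqVneq l k; first by subst; rewrite !(artin_simp, es, eqs).
have [?|lk'] := eqVneq l k.+1; first by subst; rewrite !(artin_simp, es, eqs).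
by rewrite !artin_gen (negPf lj) (negPf lj') (negPf lk) (negPf lk').
Qed.

Lemma artin_near k : artin k \o artin k.+1 \o artin k =1
  artin k.+1 \o artin k \o artin k.+1.
Proof.
apply: free_ext => [g h|g h|l] /=; rewrite ?artinM //.
rewrite -/(gen l) !artin_gen.
have [?|lk] := eqVneq l k; first by subst; do ?rewrite !artin_simp !eqs; rewrite [RHS]conjJg.
have [?|lk'] := eqVneq l k.+1; first by subst; do ?rewrite !artin_simp !eqs.
have [?|lk2] := eqVneq l k.+2; first by subst; do ?rewrite !artin_simp !eqs.
by do ?rewrite !artin_gen ?(negPf lk) ?(negPf lk') ?(negPf lk2).
Qed.

Definition transp k j := if j == k then k.+1 else if j == k.+1 then k else j.

(** A pair (g, j) stands for the conjugate gen j ^ g, on which artin k acts.  It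
is g that is kept, because this element, modulo gen j, is the one on which the
pushes of string j will act by multiplication. *)
Definition string_act (k : nat) (p : F * nat) : F * nat :=
  ((if p.2 == k then gen k else 1) * artin k p.1, transp k p.2).
Definition string_actV (k : nat) (p : F * nat) : F * nat :=
  ((if p.2 == k.+1 then (gen k.+1)^-1 else 1) * artinV k p.1, transp k p.2).

Lemma string_actK k : cancel (string_actV k) (string_act k).
Proof.
case=> g j; rewrite /string_act /string_actV /transp /=.
have [->|jk] := eqVneq j k.
  by rewrite !eqs !mul1g artinK.
have [->|jk'] := eqVneq j k.+1.
  by rewrite !eqs artinM artinK artin_inv artin_gen !eqs mulVKg.
by rewrite (negPf jk) (negPf jk') !mul1g artinK.
Qed.

Lemma string_actVK k : cancel (string_act k) (string_actV k).
Proof.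
case=> g j; rewrite /string_act /string_actV /transp /=.
have [->|jk] := eqVneq j k.
  by rewrite !eqs artinVM artinVK artinV_gen !eqs mulKg.
have [->|jk'] := eqVneq j k.+1.
  by rewrite !eqs !mul1g artinVK.
by rewrite (negPf jk) (negPf jk') !mul1g artinVK.
Qed.

Lemma artin1 k : artin k 1 = 1.
Proof. exact: free_lift1. Qed.

Lemma string_act_far j k : j.+1 < k -> string_act j \o string_act k =1 string_act k \o string_act j.
Proof.
move=> jk [g i]; rewrite /string_act /= !artinM !mulgA.
rewrite -[artin j (artin k g)]/((artin j \o artin k) g) (artin_far jk) /= /transp.
have es := far_eqs jk; pose simps := (artin1, artin_gen, mul1g, mulg1, es, eqs).
have [?|n1] := eqVneq i j; first by subst; rewrite !simps.
have [?|n2] := eqVneq i j.+1; first by subst; rewrite !simps.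
have [?|n3] := eqVneq i k; first by subst; rewrite !simps.
have [?|n4] := eqVneq i k.+1; first by subst; rewrite !simps.
by rewrite ?(negPf n1) ?(negPf n2) ?(negPf n3) ?(negPf n4) !simps.
Qed.

Lemma string_act_near k : string_act k \o string_act k.+1 \o string_act k =1
  string_act k.+1 \o string_act k \o string_act k.+1.
Proof.
move=> [g i]; rewrite /string_act /= !artinM !mulgA.
rewrite -[artin k (artin _ (artin k g))]/((artin k \o artin k.+1 \o artin k) g).
rewrite artin_near /= /transp.
have [?|n1] := eqVneq i k.
  subst; do ?rewrite !(artin1, artin_simp, mul1g, mulg1, eqs).
  by rewrite conjgE !mulgA mulgV mul1g.
have [?|n2] := eqVneq i k.+1.
  by subst; do ?rewrite !(artin1, artin_simp, mul1g, mulg1, eqs).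
have [?|n3] := eqVneq i k.+2.
  by subst; do ?rewrite !(artin1, artin_simp, mul1g, mulg1, eqs).
by do 3!rewrite ?(negPf n1) ?(negPf n2) ?(negPf n3) ?artin1 ?mul1g /=.
Qed.

Section BraidAct.
Context (n : nat).
Local Notation m := n.-1.
Local Notation s := (sig n).

Let letter_act (l : 'I_m * bool) := if l.2 then string_actV l.1 else string_act l.1.

Definition act (g : braid n) (p : F * nat) : F * nat := foldr letter_act p (repr g).

Lemma letter_act_rel u v : grp_rel (@braid_rel n) u v ->
  forall p, foldr letter_act p u = foldr letter_act p v.
Proof.
case=> [i [] /= p|{}u {}v [i j ij p|i j ij p] /=].
- by rewrite /letter_act /= string_actVK.
- by rewrite /letter_act /= string_actK.
- rewrite /letter_act /= -!/((string_act _ \o string_act _) p).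
  have [lt|gt] : (i.+1 < j) \/ (j.+1 < i) by lia.
    exact: string_act_far.
  by symmetry; apply: string_act_far.
- rewrite /letter_act /=.
  have [e|e] : i.+1 = j :> nat \/ j.+1 = i :> nat by lia.
    by rewrite -e; apply: (string_act_near i p).
  by rewrite -e; symmetry; apply: (string_act_near j p).
Qed.

Lemma act_class w p : act (pres_class _ w) p = foldr letter_act p w.
Proof.
apply: (@foldr_congr _ _ letter_act xpredT (grp_rel (@braid_rel n))) => //.
  by move=> u v uv q _; apply: letter_act_rel.
exact: pres_repr_class.
Qed.

Lemma act1 p : act 1 p = p.
Proof. exact: act_class. Qed.

Lemma actM g h p : act (g * h) p = act g (act h p).
Proof.
rewrite -[g]pres_class_repr -[h]pres_class_repr [_ * _]pres_mul_class !act_class.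
by rewrite foldr_cat.
Qed.

Lemma act_sig k p : k < m -> act (s k) p = string_act k p.
Proof. by move=> km; rewrite (sig_sigma (Ordinal km)) act_class. Qed.

Lemma act_sigV k p : k < m -> act (s k)^-1 p = string_actV k p.
Proof. by move=> km; rewrite -{1}(string_actK k p) -act_sig // -actM mulVg act1. Qed.

End BraidAct.
End ArtinAction.

(** * The action over the first string *)
Section FiberZero.
Local Open Scope group_scope.
Context (n : nat).
Local Notation m := n.-1.
Local Notation F := (free_group nat).
Local Notation s := (sig n).
Local Notation X := (push n).
Local Notation act := (act (n:=n)).
Local Notation D := (fun k : nat => k < m).

(** Filling in the puncture of string 0; generators are renumbered so that letter
j belongs to string j.+1, as in [push j]. *)
Definition forget0 : F -> F := free_lift (fun l => if l is j.+1 then gen j else 1).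

Lemma forget0M : {morph forget0 : g h / g * h}. Proof. exact: free_liftM. Qed.
Lemma forget0V g : forget0 g^-1 = (forget0 g)^-1. Proof. exact: free_liftV. Qed.
Lemma forget0_gen l : forget0 (gen l) = if l is j.+1 then gen j else 1.
Proof. by rewrite /forget0 free_lift_lett. Qed.
Lemma forget0_conj g h : forget0 (g ^ h) = forget0 g ^ forget0 h.
Proof. by rewrite !conjgE !forget0M forget0V. Qed.

Definition forget0_simp := (forget0_conj, forget0M, forget0V, forget0_gen).

Lemma forget0_artin k g : forget0 (artin k.+1 g) = artin k (forget0 g).
Proof.
move: g; apply: free_ext => [g h|g h|l] /=; rewrite ?(artinM, forget0M) //.
rewrite -/(gen l) artin_gen; case: l => [|l]; first by rewrite !forget0_simp artin1.
rewrite !eqSS forget0_gen artin_gen.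
by case: eqP => _; last case: eqP => _; rewrite !forget0_simp.
Qed.

Lemma forget0_artinV k g : forget0 (artinV k.+1 g) = artinV k (forget0 g).
Proof. by rewrite -{2}(artinK k.+1 g) forget0_artin artinVK. Qed.

Lemma forget0_artin0 g : forget0 (artin 0 (artin 0 g)) = forget0 g.
Proof.
move: g; apply: free_ext => [g h|g h|l] /=; rewrite ?(artinM, forget0M) //.
rewrite -/(gen l); case: l => [|[|l]].
- by rewrite !(artin_simp, forget0_simp) /= !conj1g.
- by rewrite !(artin_simp, forget0_simp) /= conjg1.
- by rewrite !artin_gen.
Qed.

Lemma forget0_artinV0 g : forget0 (artinV 0 (artinV 0 g)) = forget0 g.
Proof. by rewrite -{2}(artinK 0 g) -{2}(artinK 0 (artinV 0 g)) forget0_artin0. Qed.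

Lemma act_sig_succ k b g : k.+1 < m ->
  act (inv_if b (s k.+1)) (g, 0) = ((if b then artinV k.+1 g else artin k.+1 g), 0).
Proof.
by move=> km; case: b; rewrite /= ?act_sig ?act_sigV // /string_act /string_actV /transp /= mul1g.
Qed.

(** For j = 0 this is a computation, and conjugation by sig j.+1, which acts by an
Artin automorphism, leads from j to j.+1. *)
Lemma act_push j b g : j < m -> exists g',
  act (ev_letter X (j, b)) (g, 0) = (g', 0) /\ forget0 g' = lett (j, b) * forget0 g.
Proof.
elim: j b g => [|j IHj] b g jm.
  rewrite /ev_letter /push /= invg1 conjg1 expg2; case: b.
    rewrite invgM actM !act_sigV // /string_actV /transp /= mul1g.
    eexists; split; first by []; rewrite forget0M forget0_artinV0 forget0V.
    by rewrite forget0_gen lett_gen.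
  rewrite actM !act_sig // /string_act /transp /= mul1g.
  eexists; split; first by []; rewrite artinM forget0M forget0_artin0.
  by rewrite !(artin_simp, forget0_simp) conjg1.
have -> : ev_letter X (j.+1, b) = (s j.+1)^-1 * (ev_letter X (j, b) * s j.+1).
  by rewrite -conjgE /ev_letter /=; case: b; rewrite ?conjVg push_succ.
rewrite !actM (act_sig_succ false _ jm) /=.
have [g' [-> e]] := IHj b (artin j.+1 g) (ltnW jm).
rewrite (act_sig_succ true _ jm); eexists; split; first by [].
rewrite forget0_artinV e artinVM forget0_artin artinVK; congr (_ * _).
by rewrite !lett_gen /=; case: (b); rewrite ?artinV_inv artinV_gen eqxx.
Qed.

Let fib (p : F * nat) := p.2 = 0.

(** Here z is the letter j itself, by which v = push j multiplies, and Y consists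
of all the other letters. *)
Lemma pair_push j u : j < m -> pushing_conj u -> eq_or_dichotomy u (X j).
Proof.
move=> jm [x [g [xm [w Dw ->] ->]]].
pose r (p : F * nat) := nf (forget0 p.1).
apply: (@conj_dichotomy _ _ X D j (fun a => a != j) false (X j) _ act fib r _ _ _ _ _ _ _ _ D) => //.
- exact: act1.
- exact: actM.
- by move=> o _; apply: nf_reduced.
- move=> [a b] [h i] /= am; rewrite /fib /= => ->.
  have [h' [-> e]] := act_push b h am; split=> //.
  by rewrite /r /= e nf_lett.
- move=> b [h i]; rewrite /fib /= => ->.
  have [h' [e1 e]] := act_push b h jm; rewrite [ev_letter _ _]/ev_letter /= in e1.
  rewrite e1; split=> // l _ pl.
  by rewrite /r /= e nf_lett profile_step_z pl.
- by rewrite eqxx.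
- by move=> a _ /negPn/eqP ->.
- exists (gen j.+2, 0), j.+1; split=> //; first by lia.
  by rewrite /r /= forget0_gen -[gen _]mulg1 nf_lett nf1.
- by move=> a _ /negPn/eqP ->; left.
Qed.

Lemma push0_order : 0 < m -> inf_order (X 0).
Proof.
move=> m0 k e.
have act_pow i : exists g, act (X 0 ^+ i) (1, 0) = (g, 0) /\
    nf (forget0 g) = nseq i (0, false).
  elim: i => [|i [g [e1 e2]]]; first by exists 1; rewrite act1 /forget0 free_lift1 nf1.
  have [g' [e3 e4]] := act_push false g m0; rewrite [ev_letter _ _]/ev_letter /= in e3.
  exists g'; rewrite expgS actM e1 e3; split=> //.
  by rewrite e4 nf_lett e2; case: (i).
have [g []] := act_pow k.+1; rewrite e act1 => -[<-].
by rewrite /forget0 free_lift1 nf1.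
Qed.

Section Disjoint.
Context (i : nat) (im : i.+1 < m).

(** Coordinates in a basis that contains the product of the letters of the two
strings crossed by sig i.+1: letter i now denotes this product, and the old
letter i is expressed through it. *)
Definition rebase : F -> F :=
  free_lift (fun l => if l == i then (gen i.+1)^-1 * gen i else gen l).

Lemma rebaseM : {morph rebase : g h / g * h}. Proof. exact: free_liftM. Qed.
Lemma rebaseV g : rebase g^-1 = (rebase g)^-1. Proof. exact: free_liftV. Qed.
Lemma rebase_gen l : rebase (gen l) = if l == i then (gen i.+1)^-1 * gen i else gen l.
Proof. by rewrite /rebase free_lift_lett. Qed.
Lemma rebase_conj g h : rebase (g ^ h) = rebase g ^ rebase h.
Proof. by rewrite !conjgE !rebaseM rebaseV. Qed.

Definition rebase_simp := (rebase_conj, rebaseM, rebaseV, rebase_gen).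

(** The square of an Artin automorphism conjugates both letters by their product;
in the new basis only letter i.+1 is moved. *)
Definition twist (b : bool) : F -> F :=
  free_lift (fun l => if l == i.+1 then gen l ^ (lett (i, b)) else gen l).

Lemma twistM b : {morph twist b : g h / g * h}. Proof. exact: free_liftM. Qed.
Lemma twistV b g : twist b g^-1 = (twist b g)^-1. Proof. exact: free_liftV. Qed.
Lemma twist_gen b l : twist b (gen l) = if l == i.+1 then gen l ^ (lett (i, b)) else gen l.
Proof. by rewrite /twist free_lift_lett. Qed.

Lemma rebase_artin2 g : rebase (artin i (artin i g)) = twist false (rebase g).
Proof.
move: g; apply: free_ext => [g h|g h|l] /=; rewrite ?(artinM, rebaseM, twistM) //.
rewrite -/(gen l).
have [?|n1] := eqVneq l i; first subst l.
  do ?rewrite !(artin_simp, rebase_simp, eqs, twistM, twistV, twist_gen).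
  by rewrite lett_gen /= !conjgE; rewrite ?(invgM, invgK) !mulgA; do ?rewrite !(mulgK, mulgVK, mulgV, mulVg, mul1g, mulg1).
have [?|n2] := eqVneq l i.+1; first subst l.
  do ?rewrite !(artin_simp, rebase_simp, eqs, twistM, twistV, twist_gen).
  by rewrite lett_gen /= !conjgE; rewrite ?(invgM, invgK) !mulgA; do ?rewrite !(mulgK, mulgVK, mulgV, mulVg, mul1g, mulg1).
by rewrite !(artin_gen, rebase_gen, twist_gen, negPf n1, negPf n2).
Qed.

Lemma rebase_artinV2 g : rebase (artinV i (artinV i g)) = twist true (rebase g).
Proof.
have tw h : twist true (twist false h) = h.
  move: h; apply: (free_ext (f2 := id)) => [h h'|h h'|l] /=; rewrite ?twistM //.
  rewrite -/(gen l) twist_gen; have [->|n1] := eqVneq l i.+1; last first.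
    by rewrite twist_gen (negPf n1).
  rewrite conjgE !twistM twistV !lett_gen /= !(twist_gen, eqs) lett_gen /= conjgE.
  by rewrite !mulgA; do ?rewrite !(mulgK, mulgVK, mulgV, mulVg, mul1g, mulg1).
by rewrite -{2}(artinK i g) -{2}(artinK i (artinV i g)) rebase_artin2 tw.
Qed.

Definition push_basis (a : nat) : braid n := if a == i then X i.+1 * X i else X a.

Let r (p : F * nat) := nf (rebase (forget0 p.1)).

Lemma act_push_basis a b g : a < m -> exists g',
  act (ev_letter push_basis (a, b)) (g, 0) = (g', 0) /\
  rebase (forget0 g') = lett (a, b) * rebase (forget0 g).
Proof.
move=> am; rewrite /ev_letter /push_basis /=; case: eqP => [->|/eqP ai].
  case: b; last first.
    have [g1 [e1 f1]] := act_push false g (ltnW im); have [g2 [e2 f2]] := act_push false g1 im.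
    rewrite /ev_letter /= in e1 e2; exists g2; rewrite actM e1 e2; split=> //.
    by rewrite f2 f1 !rebaseM !lett_gen /= !rebase_gen !eqs mulgA mulVKg.
  have [g1 [e1 f1]] := act_push true g im; have [g2 [e2 f2]] := act_push true g1 (ltnW im).
  rewrite /ev_letter /= in e1 e2; exists g2; rewrite invgM actM e1 e2; split=> //.
  rewrite f2 f1 !rebaseM !lett_gen /= !rebaseV !rebase_gen !eqs invgM invgK mulgA.
  by rewrite mulgK.
have [g' [e f]] := act_push b g am; exists g'; rewrite -e; split=> //.
rewrite f rebaseM; congr (_ * _); rewrite !lett_gen /=.
by case: (b); rewrite ?rebaseV rebase_gen (negPf ai).
Qed.

Lemma act_sqr b g : exists g',
  act (if b then (s i.+1 ^+ 2)^-1 else s i.+1 ^+ 2) (g, 0) = (g', 0) /\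
  rebase (forget0 g') = twist b (rebase (forget0 g)).
Proof.
rewrite expg2; case: b.
  rewrite invgM actM !(act_sig_succ true) //; eexists; split; first by [].
  by rewrite !forget0_artinV rebase_artinV2.
rewrite actM !(act_sig_succ false) //; eexists; split; first by [].
by rewrite !forget0_artin rebase_artin2.
Qed.

Lemma twist_lett b l : l.1 == i.+1 ->
  twist b (lett l) = lett (i, ~~ b) * lett l * (lett (i, ~~ b))^-1.
Proof.
case: l => a c /= /eqP ->; rewrite -[(i, ~~ b)]/(linv (i, b)) lettV invgK -mulgA -conjgE.
by rewrite lett_gen /=; case: c; rewrite ?twistV twist_gen eqxx ?conjVg.
Qed.

Lemma twist_lettN b l : l.1 != i.+1 -> twist b (lett l) = lett l.
Proof.
case: l => a c /= /negPf ai; rewrite lett_gen /=.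
by case: c; rewrite ?twistV twist_gen ai.
Qed.

Lemma word_value_basis g : word_value X D g -> word_value push_basis D g.
Proof.
apply: (word_value_map (phi := id)) => // a am.
have [->|ai] := eqVneq a i; last first.
  have -> : X a = push_basis a by rewrite /push_basis (negPf ai).
  exact: word_value_letter.
have -> : X i = (push_basis i.+1)^-1 * push_basis i by rewrite /push_basis !eqs mulKg.
apply: word_valueM; last by apply: word_value_letter; apply: ltnW.
by apply/word_valueV/word_value_letter.
Qed.

Lemma push_basis_commute a : a < m -> a != i.+1 -> commute (push_basis a) (s i.+1 ^+ 2).
Proof.
move=> am ai; apply: commuteX; rewrite /push_basis; case: eqP => [_|/eqP ai'].
  exact: push_prod_commute.
by apply: push_commute => //; lia.
Qed.

(** The square of sig i.+1 preserves the points with the empty word, which the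
nontrivial powers of push_basis a move to other words. *)
Lemma indep_sqr a : inf_order (s i.+1 ^+ 2) -> a < m ->
  indep (push_basis a) (s i.+1 ^+ 2).
Proof.
move=> os am.
have r1 : rebase (forget0 1) = 1 by rewrite /forget0 free_lift1 /rebase free_lift1.
have pow_v k : exists g', act ((s i.+1 ^+ 2) ^+ k) (1, 0) = (g', 0) /\
    rebase (forget0 g') = 1.
  elim: k => [|k [g' [e1 e2]]]; first by exists 1; rewrite act1.
  have [g2 [e3 e4]] := act_sqr false g'; exists g2; rewrite expgS actM e1 e3; split=> //.
  by rewrite e4 e2 /twist free_lift1.
have pow_X c k : exists g', act (ev_letter push_basis (a, c) ^+ k) (1, 0) = (g', 0) /\
    nf (rebase (forget0 g')) = nseq k (a, c).
  elim: k => [|k [g' [e1 e2]]].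
    by exists 1; rewrite act1 r1 nf1.
  have [g2 [e3 e4]] := act_push_basis c g' am; exists g2; rewrite expgS actM e1 e3; split=> //.
  rewrite e4 nf_lett e2; case: (k) => [|k'] //=; case: eqP => // /(congr1 snd) /=.
  by case: (c).
have disj c k l : ev_letter push_basis (a, c) ^+ k = (s i.+1 ^+ 2) ^+ l -> k = 0.
  move=> e; have [g1 [e1 f1]] := pow_X c k; have [g2 [e2 f2]] := pow_v l.
  move: f1; rewrite e e2 in e1; case: e1 => <-; rewrite f2 nf1.
  by case: k {e}.
move=> k [l [e|e]].
  have l0 := disj false l k.+1 (esym e).
  by move: e; rewrite l0 expg0; apply: os.
have l0 : l = 0 by apply: (disj true l k.+1); rewrite e -expVgn.
by move: e; rewrite l0 expg0 invg1; apply: os.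
Qed.

(** Here z is the product of two letters, and Y contains one of them.  The other
one is not in the basis; it is exchanged with the first one by a conjugation by
sig i.+1, which commutes with its own square. *)
Lemma pair_sqr u : inf_order (s i.+1 ^+ 2) -> pushing_conj u ->
  eq_or_dichotomy u (s i.+1 ^+ 2).
Proof.
move=> os.
have main x g : x < m -> x != i -> word_value X D g ->
    eq_or_dichotomy (X x ^ g) (s i.+1 ^+ 2).
  move=> xm xi /word_value_basis[w Dw ->].
  have -> : X x = push_basis x by rewrite /push_basis (negPf xi).
  apply: (@conj_dichotomy _ _ push_basis D i (pred1 i.+1) true (s i.+1 ^+ 2) _ act fib r
    _ _ _ _ _ _ _ _ D) => //.
  - exact: act1.
  - exact: actM.
  - by move=> o _; apply: nf_reduced.
  - move=> [a b] [h j] /= am; rewrite /fib /= => ->.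
    have [h' [-> e]] := act_push_basis b h am; split=> //.
    by rewrite /r /= e nf_lett.
  - move=> b [h j]; rewrite /fib /= => ->.
    have [h' [-> e]] := act_sqr b h; split=> // l Yl pl.
    rewrite /r /= e (@profile_twist _ i (~~ b) (pred1 i.+1)).
    + by rewrite /shift_profile pl /= (eqP Yl) eqxx.
    + exact: twistM.
    + by rewrite /= eqnS.
    + exact: twist_lett.
    + exact: twist_lettN.
  - by rewrite /= eqnS.
  - by move=> a am ai; apply: push_basis_commute.
  - exists (gen i.+2, 0), i.+1; split=> //=.
    by rewrite /r /= forget0_gen rebase_gen !eqs -[gen _]mulg1 nf_lett nf1.
  - move=> a am ai; right; left; split; first exact: push_basis_commute.
    exact: indep_sqr.
move=> [x [g [xm pg ->]]]; have [->|xi] := eqVneq x i; last exact: main.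
have -> : s i.+1 ^+ 2 = (s i.+1 ^+ 2) ^ (s i.+1)^-1.
  exact/esym/conjg_fixP/commgP/commute_sym/commuteX/commute_sym/commuteV.
apply/(eq_or_dichotomy_conjg _ _ (s i.+1)).
rewrite conjgKV -conjgM conjgC conjgM push_succ //.
apply: main => //; first by rewrite eqSn.
exact: (pushingJ_sig false im pg).
Qed.

End Disjoint.
End FiberZero.

(** * Pairs of conjugates of squared generators *)
Section BraidPairs.
Local Open Scope group_scope.
Context (n : nat).
Local Notation m := n.-1.
Local Notation s := (sig n).

Lemma Upsilon_conj (u : braid n) : in_Upsilon u ->
  0 < m /\ exists g, u = push n 0 ^ g.
Proof.
case/asboolP=> a [i ->]; split; first exact: leq_ltn_trans (leq0n i) (ltn_ord i).
have [g e] := sig_conj0 (ltn_ord i); exists (g * a^-1).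
by rewrite /push /= invg1 conjg1 -(sig_sigma i) conjgM conjXg -e conjgE invgK !expg2 !mulgA.
Qed.

Lemma Upsilon_order (u : braid n) : in_Upsilon u -> inf_order u.
Proof. by move=> /Upsilon_conj[m0 [g ->]]; apply/inf_order_conjg/push0_order. Qed.

(** Conjugating u to push 0 and then combing the conjugator of v. *)
Lemma Upsilon_pair (u v : braid n) :
  in_Upsilon u -> in_Upsilon v -> eq_or_dichotomy u v.
Proof.
move=> /Upsilon_conj[m0 [g ->]] /asboolP[a [i ->]].
apply/(eq_or_dichotomy_conjg _ _ g^-1); rewrite conjgK.
have -> : (a * sigma i ^+ 2 * a^-1) ^ g^-1 = s i ^+ 2 ^ (g * a)^-1.
  by rewrite sig_sigma invgM conjgM; congr (_ ^ _); rewrite conjgE invgK !expg2 !mulgA.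
have [h [k [km fh ->]]] := comb (g * a).
apply/(eq_or_dichotomy_conjg _ _ h).
rewrite invgM conjgM conjgKV.
have pu : pushing_conj (push n 0 ^ h).
  apply: fix0_conj => //; exists 0, 1; split=> //; last by rewrite conjg1.
  exact: word_value1.
case: (carry_conj_sqr km (ltn_ord i)) => -[j jm ->]; first exact: pair_push.
apply: pair_sqr => //.
have [h' e] := sig_conj0 jm; rewrite e -conjXg.
apply: inf_order_conjg; have := push0_order m0.
by rewrite /push /= invg1 conjg1.
Qed.

End BraidPairs.

Theorem theorem1p3 (n : nat) (n_gt0 : 0 < n) : injective (nu n).
Proof.
move=> a b; rewrite -[a]pres_class_repr -[b]pres_class_repr /nu.
rewrite !(pres_lift_class (@nu_gen_rel n)) => e.
apply/pres_classP.
apply: (@prod_sub1_inj _ _ (val : Upsilon n -> braid n)).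
- by move=> x; apply/Upsilon_order/(valP x).
- move=> x y xy; case: (Upsilon_pair (valP x) (valP y)) => // /val_inj //.
- move=> x y /eqP xy c; apply: GraphRel; rewrite /= /Omega_edge xy /=.
  exact/eqP.
- exact: e.
Qed.
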